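(* Let $q_0$ be a prime power such that $\Delta=\frac{q_0+1}{2}$ is a prime greater than $3$, and let $q=q_0^2$. Let $\mathcal X_1$ be the non-singular model of the plane curve over $\mathbb F_q$ with affine equation $$X^{4}+X^{2}+Y^{q_0+1}=0 .$$ Let $P_3$ be an $\mathbb F_q$-rational point of $\mathcal X_1$ whose Weierstrass semigroup $H(P_3)$ contains $q_0+1$, $q_0+1-\Delta$, and the integers $q_0+1-(\Delta-2j)$ for $j=1,2,\ldots,\frac{\Delta-1}{2}$. Then $$H(P_3)=\left\langle q_0+1-\Delta,\ q_0+1-(\Delta-2),\ q_0+1-(\Delta-4),\ \ldots,\ q_0,\ q_0+1\right\rangle .$$
   Context: Curves are projective, geometrically irreducible, non-singular algebraic curves over a finite field. For an $\mathbb F_q$-rational point $P$, $H(P)$ is the Weierstrass semigroup of non-gaps at $P$: the set of integers $n\ge 0$ such that there is a rational function with pole divisor $nP$. $\langle a_1,\dots,a_r\rangle$ denotes the numerical semigroup (containing $0$) generated by $a_1,\dots,a_r$. It is known (Giulietti–Hirschfeld–Korchmáros–Torres) that $\mathcal X_1$ has genus $q_0-1$ and that a point $P_3$ with the stated property exists. *)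

(* Defs.v *)
From mathcomp Require Import all_boot all_order all_algebra.

Set Implicit Arguments.
Unset Strict Implicit.
Unset Printing Implicit Defensive.

Import Order.TTheory GRing.Theory Num.Theory.
Local Open Scope ring_scope.

(* Bivariate polynomials follow the conventions of [polyXY]: 'X is the outer
   variable, 'Y = 'X%:P is the inner one, and [u.[a, b]] evaluates 'X at a and
   'Y at b. *)
Definition eval_in (K L : fieldType) (iota : {rmorphism K -> L})
    (u : {poly {poly K}}) (x y : L) : L :=
  (map_poly (map_poly iota) u).[x, y].

(* [L], with the embedding [iota] of the constants and the coordinate functions
   [x] and [y], is the fraction field of the coordinate ring K[X, Y] / (f).
   As L is a field, this forces (f) to be a prime ideal. *)
Record is_function_field (K L : fieldType) (iota : {rmorphism K -> L})
    (f : {poly {poly K}}) (x y : L) : Prop := IsFunctionField {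
  relations_generated : forall u : {poly {poly K}},
    eval_in iota u x y = 0 <-> exists h : {poly {poly K}}, u = h * f;
  field_generated : forall z : L, exists u w : {poly {poly K}},
    eval_in iota w x y != 0 /\ z = eval_in iota u x y / eval_in iota w x y
}.

(* The closed points of the non-singular projective model of a curve with
   function field L over K are the places of L / K, represented here by their
   normalized discrete valuations.  The value at 0, normally +oo, is set to 0
   by convention, so that a place is determined by the function [ord_at]. *)
Record place (K L : fieldType) (iota : {rmorphism K -> L}) := Place {
  ord_at : L -> int;
  ord_at0 : ord_at 0 = 0;
  ord_mul : forall z w : L, z != 0 -> w != 0 -> ord_at (z * w) = ord_at z + ord_at w;
  ord_add : forall z w : L, z != 0 -> w != 0 -> z + w != 0 ->
    Num.min (ord_at z) (ord_at w) <= ord_at (z + w);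
  ord_const : forall c : K, c != 0 -> ord_at (iota c) = 0;
  ord_normalized : exists2 t : L, t != 0 & ord_at t = 1
}.

(* P has degree one: every regular function at P is congruent to a constant
   modulo the maximal ideal. *)
Definition rational_point (K L : fieldType) (iota : {rmorphism K -> L})
    (P : place iota) : Prop :=
  forall z : L, z != 0 -> 0 <= ord_at P z ->
    exists c : K, z = iota c \/ 0 < ord_at P (z - iota c).

Definition same_place (K L : fieldType) (iota : {rmorphism K -> L})
    (P Q : place iota) : Prop := ord_at P =1 ord_at Q.

(* The coefficient at Q of the pole divisor of z. *)
Definition pole_order (K L : fieldType) (iota : {rmorphism K -> L})
    (Q : place iota) (z : L) : int := Num.max 0 (- ord_at Q z).

Definition has_pole_divisor (K L : fieldType) (iota : {rmorphism K -> L})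
    (z : L) (n : nat) (P : place iota) : Prop :=
  [/\ z != 0, pole_order P z = n%:Z &
      forall Q : place iota, ~ same_place Q P -> pole_order Q z = 0].

Definition weierstrass_semigroup (K L : fieldType) (iota : {rmorphism K -> L})
    (P : place iota) (n : nat) : Prop :=
  exists z : L, has_pole_divisor z n P.

Definition generated_semigroup (s : seq nat) (n : nat) : Prop :=
  exists c : 'I_(size s) -> nat, n = (\sum_(i < size s) c i * nth 0 s i)%N.

Definition X1_poly (K : fieldType) (q0 : nat) : {poly {poly K}} :=
  'X^4 + 'X^2 + 'Y ^+ q0.+1.

(* q0 + 1 - Delta, q0 + 1 - (Delta - 2), ..., q0 + 1 - 1 (for Delta odd),
   followed by q0 + 1. *)
Definition P3_generators (q0 Delta : nat) : seq nat :=
  rcons [seq q0.+1 - (Delta - j.*2) | j <- iota 0 (Delta.-1)./2.+1]%N q0.+1.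

(* Main.v *)
From HB Require Import structures.
Require Import Defs.
From mathcomp Require Import all_boot all_order all_algebra all_field.
From mathcomp Require Import boolp ring lra zify.

Set Implicit Arguments.
Unset Strict Implicit.
Unset Printing Implicit Defensive.

Import Order.TTheory GRing.Theory Num.Theory.
Local Open Scope ring_scope.

(** Put [w = Y^Delta / X]. The equation of the curve becomes [w^2 + X^2 = -1], a
    conic which, as -1 is a square in [K], is parametrized by [t = w + i X].
    Since [Y^Delta = w X], the function field is the Kummer extension
    [K(t, y)] of the rational function field [K(t)] given by
    [y^Delta = C (t^2 - t^-2)]. It is totally ramified above [0], infinity and
    the four roots of [t^4 = 1], and unramified elsewhere.

    The semigroup [S] generated by the numbers of the statement consists of the
    [Delta a + 2 b] with [2 b <= Delta a] (monomial_order_generated). These are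
    the pole orders at [t = oo] of the monomials [t^a y^b] that have no pole at
    [t = 0]. Every function without finite poles is a combination of such
    monomials, and at infinity their orders are distinct, so that a single one
    of them governs (regular_pole). Hence, if [P3] is a pole of [t], its
    semigroup is [S] (weierstrass_pole).

    If [P3] is not a pole of [t], let [Q] be the point at infinity. The
    semigroup of [P3] contains [S] by hypothesis, and it cannot be larger,
    because it has as many gaps as the one of [Q]: this is the fact that the
    genus can be computed at any point. Its proof compares two counts for the
    functions with poles of order at most [m] at [P3] and at most [N] at [Q]. On
    the one hand, there are such functions of every order [-1, ..., -N] at [Q],
    namely monomials [t^a y^b] multiplied by powers of a function which vanishes
    at [Q] and has its poles at [P3] (all_orders_at_infinity). Together with the
    functions whose only pole is [P3] they give [N] plus the number of nongaps
    of [P3] in [[0, m]]. On the other hand, removing the poles at [P3] costs at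
    most [m] dimensions, and what is left has pole orders in [S] at [Q]. As [S]
    contains all large integers, a single nongap of [P3] outside [S] contradicts
    the comparison (weierstrass_finite).

    Both parts need enough places to detect the poles of a function. They are
    obtained as localizations of rings [K[t, s]] with [s^d] in [K[t]] at a prime,
    where the maximal ideal is principal (dvr_place): it is generated by [s] where
    [s^d] has a simple zero (ramified_place), and by a prime [pi(t)] at the
    primes above [pi] that correspond to the irreducible factors of
    [X^d - g] modulo [pi] where [g = s^d] is nonzero (unramified_place). *)

(** * Orders at a place *)

Section PlaceTheory.

Variables (K L : fieldType) (iota : {rmorphism K -> L}) (P : place iota).
Implicit Types (z w : L) (c : int) (n : nat).

Local Notation v := (ord_at P).

Lemma ord_one : v 1 = 0.
Proof. by rewrite -(rmorph1 iota) ord_const ?oner_eq0. Qed.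

Lemma ordN z : v (- z) = v z.
Proof.
have [->|z0] := eqVneq z 0; first by rewrite oppr0.
rewrite -mulN1r ord_mul ?oppr_eq0 ?oner_eq0 //.
by rewrite -(rmorph1 iota) -rmorphN ord_const ?add0r // oppr_eq0 oner_eq0.
Qed.

Lemma ordV z : v z^-1 = - v z.
Proof.
have [->|z0] := eqVneq z 0; first by rewrite invr0 ord_at0 oppr0.
apply/eqP; rewrite -addr_eq0 -ord_mul ?invr_eq0 //.
by rewrite mulVf // ord_one.
Qed.

Lemma ordX z n : v (z ^+ n) = v z *+ n.
Proof.
have [->|z0] := eqVneq z 0.
  by rewrite expr0n; case: n => [|n] /=; rewrite ?ord_one ?ord_at0 ?mul0rn.
elim: n => [|n IHn]; first by rewrite ord_one.
by rewrite exprS ord_mul ?expf_neq0 // IHn mulrS.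
Qed.

Lemma ord_const0 (a : K) : v (iota a) = 0.
Proof.
have [->|/ord_const //] := eqVneq a 0.
by rewrite rmorph0 ord_at0.
Qed.

(** The valuation of 0 being infinite, inequalities between valuations are
    only meaningful together with this escape clause. *)
Definition ord_ge (c : int) (z : L) := (z == 0) || (c <= v z).

Lemma ord_ge_neq0 c z : z != 0 -> ord_ge c z = (c <= v z).
Proof. by rewrite /ord_ge => /negPf->. Qed.

Lemma ord_ge0 c : ord_ge c 0.
Proof. by rewrite /ord_ge eqxx. Qed.

Lemma ord_ge_le c c' z : c' <= c -> ord_ge c z -> ord_ge c' z.
Proof.
move=> cc' /orP[z0|cz]; first by rewrite /ord_ge z0.
by rewrite /ord_ge (le_trans cc' cz) orbT.
Qed.

Lemma ord_geD c z w : ord_ge c z -> ord_ge c w -> ord_ge c (z + w).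
Proof.
rewrite /ord_ge.
have [->|z0] := eqVneq z 0; first by rewrite add0r.
have [->|w0] := eqVneq w 0; first by rewrite addr0 (negPf z0).
have [//|zw0] := eqVneq (z + w) 0 => /= cz cw.
by apply: le_trans (ord_add P z0 w0 zw0); rewrite le_min cz.
Qed.

Lemma ord_geN c z : ord_ge c (- z) = ord_ge c z.
Proof. by rewrite /ord_ge oppr_eq0 ordN. Qed.

Lemma ord_geM c c' z w : ord_ge c z -> ord_ge c' w -> ord_ge (c + c') (z * w).
Proof.
rewrite /ord_ge mulf_eq0.
have [//|z0] := eqVneq z 0; have [//|w0] := eqVneq w 0 => /= cz cw.
by rewrite ord_mul // lerD.
Qed.

Lemma ord_ge_const (a : K) : ord_ge 0 (iota a).
Proof. by rewrite /ord_ge ord_const0 lexx orbT. Qed.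

Lemma ord_ge_sum (I : Type) (r : seq I) (Q : pred I) (F : I -> L) c :
  (forall i, Q i -> ord_ge c (F i)) -> ord_ge c (\sum_(i <- r | Q i) F i).
Proof.
by move=> FQ; apply: (big_ind (ord_ge c)); [exact: ord_ge0|exact: ord_geD|].
Qed.

Lemma ordD_lt z w : z != 0 -> ord_ge (v z + 1) w ->
  z + w != 0 /\ v (z + w) = v z.
Proof.
move=> z0; have [->|w0] := eqVneq w 0; first by rewrite addr0.
rewrite ord_ge_neq0 // => zw.
have zw0 : z + w != 0.
  by apply/eqP => /eqP; rewrite addr_eq0 => /eqP E; move: zw; rewrite E ordN; lia.
split=> //; apply/eqP; rewrite eq_le; apply/andP; split.
  have := @ord_add _ _ _ P (z + w) (- w) zw0; rewrite oppr_eq0 addrK ordN.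
  by move=> /(_ w0 z0); lia.
by have := ord_add P z0 w0 zw0; lia.
Qed.

(** When the nonzero terms of a sum have pairwise distinct valuations, nothing
    cancels and the term of least valuation governs. *)
Lemma ord_sum_distinct (I : finType) (F : I -> L) :
    (exists i, F i != 0) ->
    (forall i j, F i != 0 -> F j != 0 -> v (F i) = v (F j) -> i = j) ->
  exists2 i0, F i0 != 0 &
    [/\ \sum_i F i != 0, v (\sum_i F i) = v (F i0)
      & forall j, F j != 0 -> v (F i0) <= v (F j)].
Proof.
move=> [i1 Fi1] Finj.
case: (@Order.TotalTheory.arg_minP _ int I i1 (fun i => F i != 0)
         (fun i => v (F i)) Fi1) => i0 Fi0 i0_min.
exists i0 => //; rewrite (bigD1 i0) //=.
have [||sum0 ordE] := @ordD_lt (F i0) (\sum_(i | i != i0) F i) => //.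
  apply: ord_ge_sum => i i_i0.
  have [->|Fi] := eqVneq (F i) 0; first exact: ord_ge0.
  rewrite ord_ge_neq0 // lezD1 lt_neqAle i0_min // andbT.
  by apply: contra i_i0 => /eqP /(Finj _ _ Fi0 Fi) ->.
Qed.

End PlaceTheory.

(** * Places from local rings *)

Section DiscreteValuationRing.

(** [A] is a subring of [L] with fraction field [L], and [m] is a prime ideal
    of [A], both given as predicates. *)
Variables (K L : fieldType) (iota : {rmorphism K -> L}) (A m : L -> Prop).

Hypothesis A_const : forall c, A (iota c).
Hypothesis A_sub : forall u w, A u -> A w -> A (u - w).
Hypothesis A_mul : forall u w, A u -> A w -> A (u * w).
Hypothesis A_frac : forall z, exists u w, [/\ A u, A w, w != 0 & z = u / w].
Hypothesis m_sub : forall u w, m u -> m w -> m (u - w).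
Hypothesis m_mul : forall u w, A u -> m w -> m (u * w).
Hypothesis m_prime : forall u w, A u -> A w -> m (u * w) -> m u \/ m w.
Hypothesis m_proper : ~ m 1.

Variable tau : L.
Hypothesis tau_neq0 : tau != 0.
Hypothesis tauA : A tau.
Hypothesis taum : m tau.
(** The localization of [A] at [m] has maximal ideal [(tau)]. *)
Hypothesis tau_gen : forall u, A u -> m u ->
  exists lam r, [/\ A lam, ~ m lam, A r & lam * u = tau * r].
(** No nonzero element is infinitely divisible by [tau] in the localization. *)
Hypothesis tau_bound : forall u, A u -> u != 0 -> exists n : nat,
  forall lam r, A lam -> ~ m lam -> A r -> lam * u <> tau ^+ n * r.

Let A0 : A 0.
Proof. by rewrite -(rmorph0 iota). Qed.
Let A1 : A 1.
Proof. by rewrite -(rmorph1 iota). Qed.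
Let A_add u w : A u -> A w -> A (u + w).
Proof.
by move=> Au Aw; rewrite -[w]opprK; apply: A_sub => //; rewrite -sub0r; apply: A_sub.
Qed.
Let A_exp u n : A u -> A (u ^+ n).
Proof. by move=> Au; elim: n => [|n IHn]; rewrite ?expr0 ?exprS //; apply: A_mul. Qed.
Let m0 : m 0.
Proof. by rewrite -(subrr tau); apply: m_sub. Qed.
Let nm_neq0 u : ~ m u -> u != 0.
Proof. by move=> nmu; apply/eqP => u0; apply: nmu; rewrite u0. Qed.
Let nm_mul u w : A u -> A w -> ~ m u -> ~ m w -> ~ m (u * w).
Proof. by move=> Au Aw nu nw /m_prime[]. Qed.

(** [val z k] says that [z] is [tau ^ k] times a unit of the localization of
    [A] at [m]. *)
Let val (z : L) (k : int) :=
  exists lam r, [/\ A lam, ~ m lam, A r, ~ m r & z * lam = tau ^ k * r].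

Let valA u : A u -> u != 0 -> exists n : nat, val u n.
Proof.
move=> Au u0; have [n] := tau_bound Au u0.
elim: n => [|n IHn] bound.
  have := @bound 1 u A1 m_proper Au; rewrite expr0 !mul1r => H.
  by case: H.
have [[lam [r [Alam nlam Ar E]]]|H] := EM (exists lam r,
    [/\ A lam, ~ m lam, A r & lam * u = tau ^+ n * r]); last first.
  by apply: IHn => lam r Alam nlam Ar E; apply: H; exists lam, r.
have [mr|nr] := EM (m r); last by exists n, lam, r; split=> //; rewrite mulrC.
have [lam' [r' [Alam' nlam' Ar' E']]] := tau_gen Ar mr.
case: (@bound (lam' * lam) r'); [exact: A_mul|exact: nm_mul|by []|].
by rewrite -mulrA E mulrCA E' exprSr mulrA.
Qed.

Let valM z w k l : val z k -> val w l -> val (z * w) (k + l).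
Proof.
move=> [a [r [Aa na Ar nr Ez]]] [b [s [Ab nb As ns Ew]]].
exists (a * b), (r * s); split; try exact: A_mul; try exact: nm_mul.
by rewrite mulrACA Ez Ew mulrACA -expfzDr.
Qed.

Let valV z k : val z k -> val z^-1 (- k).
Proof.
move=> [a [r [Aa na Ar nr Ez]]]; exists r, a; split=> //.
have z0 : z != 0.
  apply/eqP => z0; move/eqP: Ez; rewrite z0 mul0r eq_sym mulf_eq0 expfz_eq0.
  by rewrite (negPf tau_neq0) andbF (negPf (nm_neq0 nr)).
apply: (mulfI z0); rewrite mulrA divff // mul1r.
by rewrite mulrCA Ez mulrA -expfzDr // addNr expr0z mul1r.
Qed.

Let val_ex z : z != 0 -> exists k, val z k.
Proof.
move=> z0; have [u [w [Au Aw w0 E]]] := A_frac z.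
have u0 : u != 0 by apply: contraNneq z0 => u0; rewrite E u0 mul0r.
have [k uk] := valA Au u0; have [l wl] := valA Aw w0.
by exists (k%:Z - l%:Z); rewrite E; apply: valM => //; apply: valV.
Qed.

Let val_le z k l : val z k -> val z l -> k <= l.
Proof.
move=> [a [r [Aa na Ar nr Ez]]] [b [s [Ab nb As ns Ez']]].
rewrite leNgt; apply/negP => lk.
have [n nE] : exists n : nat, k = l + n.+1%:Z by exists (`|k - l|.-1)%N; lia.
have E : s * a = tau * (tau ^+ n * (r * b)).
  apply: (@mulfI _ (tau ^ l)); first by rewrite expfz_neq0.
  have F : tau ^ k = tau ^ l * (tau * tau ^+ n).
    by rewrite nE expfzDr // -exprS.
  by rewrite [LHS]mulrA -Ez' mulrAC Ez F; ring.
apply: (nm_mul As Aa ns na); rewrite E mulrC; apply: m_mul => //.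
by apply: A_mul; [apply: A_exp|apply: A_mul].
Qed.

Let val_uniq z k l : val z k -> val z l -> k = l.
Proof. by move=> zk zl; apply/eqP; rewrite eq_le (val_le zk zl) (val_le zl zk). Qed.

Let val_total z : exists k, z != 0 -> val z k.
Proof. by have [->|/val_ex[k zk]] := eqVneq z 0; [exists 0 | exists k]. Qed.

Let ord z : int := if z == 0 then 0 else sval (cid (val_total z)).

Let ordP z : z != 0 -> val z (ord z).
Proof. by move=> z0; rewrite /ord ifN //; case: cid => k; exact. Qed.

Let ordE z k : z != 0 -> val z k -> ord z = k.
Proof. by move=> z0 /(val_uniq (ordP z0)). Qed.

Let val_unit u : A u -> ~ m u -> val u 0.
Proof. by move=> Au nu; exists 1, u; split=> //; rewrite mulr1 mul1r. Qed.

(** By [tau_gen] and [tau_bound] every element of [A] is a power of [tau] times a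
    unit of the localization, so that the exponent of [tau] is a valuation. *)
Lemma dvr_place : exists P : place iota,
  [/\ ord_at P tau = 1, forall u, A u -> ~ m u -> ord_at P u = 0,
      forall u, A u -> u != 0 -> 0 <= ord_at P u,
      forall u, A u -> u != 0 -> m u -> 0 < ord_at P u
    & forall z, z != 0 -> 0 <= ord_at P z ->
        exists u w, [/\ A u, A w, ~ m w & z = u / w]].
Proof.
have ord_0 : ord 0 = 0 by rewrite /ord ifT.
have ord_M z w : z != 0 -> w != 0 -> ord (z * w) = ord z + ord w.
  move=> z0 w0; apply: ordE; first by rewrite mulf_neq0.
  by apply: valM; apply: ordP.
have ordA u : A u -> u != 0 -> 0 <= ord u.
  by move=> Au u0; have [n un] := valA Au u0; rewrite (ordE u0 un).
have ord_D z w : z != 0 -> w != 0 -> z + w != 0 ->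
    Num.min (ord z) (ord w) <= ord (z + w).
  wlog le : z w / ord z <= ord w => [IH z0 w0 zw0|z0 w0 zw0].
    case/orP: (le_total (ord z) (ord w)) => le; first exact: IH.
    by rewrite minC addrC; apply: IH => //; rewrite addrC.
  rewrite (min_idPl le).
  have [a [r [Aa na Ar nr Ez]]] := ordP z0.
  have [b [s [Ab nb As ns Ew]]] := ordP w0.
  have [n nE] : exists n : nat, ord w = ord z + n%:Z by exists `|ord w - ord z|%N; lia.
  pose u := r * b + tau ^+ n * s * a.
  have Au : A u by apply: A_add; apply: A_mul => //; apply: A_mul => //; apply: A_exp.
  have E : (z + w) * (a * b) = tau ^ ord z * u.
    rewrite mulrDl mulrA Ez (mulrC a) mulrA Ew nE expfzDr // /u.
    by rewrite mulrDr !mulrA.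
  have u0 : u != 0.
    apply/eqP => u0; move/eqP: E; rewrite u0 mulr0 !mulf_eq0 (negPf zw0).
    by rewrite (negPf (nm_neq0 na)) (negPf (nm_neq0 nb)).
  have [k [c [q [Ac nc Aq nq Eu]]]] := valA Au u0.
  suff -> : ord (z + w) = ord z + k%:Z by rewrite lerDl.
  apply: ordE => //.
  exists (a * b * c), q; split=> //; [exact: A_mul (A_mul Aa Ab) Ac| |].
    exact: nm_mul (A_mul Aa Ab) Ac (nm_mul Aa Ab na nb) nc.
  by rewrite mulrA E -mulrA Eu mulrA expfzDr.
have ord_u u : A u -> ~ m u -> ord u = 0.
  by move=> Au nu; apply: ordE; [exact: nm_neq0|exact: val_unit].
have ord_c c : c != 0 -> ord (iota c) = 0.
  move=> c0; apply: ord_u => // mc; apply: m_proper.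
  by rewrite -(rmorph1 iota) -(mulVf c0) rmorphM; apply: m_mul.
have ord_tau : ord tau = 1.
  by apply: ordE => //; exists 1, 1; split=> //; rewrite !mulr1 expr1z.
exists (Place ord_0 ord_M ord_D ord_c (ex_intro2 _ _ tau tau_neq0 ord_tau)).
split=> //= [u Au u0 mu|z z0]; last first.
  have [a [r [Aa na Ar nr E]]] := ordP z0.
  case: (ord z) E => // n E _; exists (tau ^+ n * r), a; split=> //.
    by apply: A_mul => //; apply: A_exp.
  by rewrite -[tau ^+ n * r]E mulfK // nm_neq0.
rewrite lt_def ordA // andbT; apply/eqP => ou.
have [a [r [Aa na Ar nr E]]] := ordP u0.
by case: nr; rewrite -[r]mul1r -(expr0z tau) -ou -E mulrC; apply: m_mul.
Qed.

End DiscreteValuationRing.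

(** * Generators of a function field *)

(** Evaluation is locked because unification would otherwise unfold it down to
    the coefficients of the polynomials. *)
HB.lock Definition evalX (K L : fieldType) (iota : {rmorphism K -> L}) (t : L)
  (p : {poly K}) : L := (map_poly iota p).[t].

(** The inner variable is sent to [t] and the outer one to [s]. *)
HB.lock Definition evalXY (K L : fieldType) (iota : {rmorphism K -> L}) (t s : L)
  (u : {poly {poly K}}) : L := (map_poly (evalX iota t) u).[s].

Section Evaluation.

Variables (K L : fieldType) (iota : {rmorphism K -> L}).

Local Notation evalX := (evalX iota).
Local Notation evalXY := (evalXY iota).

Fact evalX_is_zmod_morphism t : zmod_morphism (evalX t).
Proof. by move=> p q; rewrite !unlock rmorphB hornerD hornerN. Qed.

Fact evalX_is_monoid_morphism t : monoid_morphism (evalX t).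
Proof. by split=> [|p q]; rewrite !unlock ?rmorph1 ?hornerC // rmorphM hornerM. Qed.

HB.instance Definition _ (t : L) :=
  GRing.isZmodMorphism.Build {poly K} L (evalX t) (evalX_is_zmod_morphism t).
HB.instance Definition _ (t : L) :=
  GRing.isMonoidMorphism.Build {poly K} L (evalX t) (evalX_is_monoid_morphism t).

Fact evalXY_is_zmod_morphism t s : zmod_morphism (evalXY t s).
Proof. by move=> u w; rewrite !evalXY.unlock rmorphB hornerD hornerN. Qed.

Fact evalXY_is_monoid_morphism t s : monoid_morphism (evalXY t s).
Proof.
by split=> [|u w]; rewrite !evalXY.unlock ?rmorph1 ?hornerC // rmorphM hornerM.
Qed.

HB.instance Definition _ (t s : L) :=
  GRing.isZmodMorphism.Build {poly {poly K}} L (evalXY t s)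
    (evalXY_is_zmod_morphism t s).
HB.instance Definition _ (t s : L) :=
  GRing.isMonoidMorphism.Build {poly {poly K}} L (evalXY t s)
    (evalXY_is_monoid_morphism t s).

Lemma evalXE t p : evalX t p = (map_poly iota p).[t].
Proof. by rewrite evalX.unlock. Qed.

Lemma evalX_X t : evalX t 'X = t.
Proof. by rewrite evalX.unlock map_polyX hornerX. Qed.

Lemma evalX_C t c : evalX t c%:P = iota c.
Proof. by rewrite evalX.unlock map_polyC hornerC. Qed.

Lemma evalX_M t p q : evalX t (p * q) = evalX t p * evalX t q.
Proof. exact: rmorphM. Qed.

Lemma evalX_XsubC t c : evalX t ('X - c%:P) = t - iota c.
Proof. by rewrite rmorphB /= evalX_X evalX_C. Qed.

Lemma evalXY_X t s : evalXY t s 'X = s.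
Proof. by rewrite evalXY.unlock map_polyX hornerX. Qed.

Lemma evalXY_C t s p : evalXY t s p%:P = evalX t p.
Proof. by rewrite evalXY.unlock map_polyC hornerC. Qed.

Lemma evalXYD t s u w : evalXY t s (u + w) = evalXY t s u + evalXY t s w.
Proof. exact: rmorphD. Qed.

Lemma evalXYB t s u w : evalXY t s (u - w) = evalXY t s u - evalXY t s w.
Proof. exact: rmorphB. Qed.

Lemma evalXYM t s u w : evalXY t s (u * w) = evalXY t s u * evalXY t s w.
Proof. exact: rmorphM. Qed.

Lemma evalXYX t s u n : evalXY t s (u ^+ n) = evalXY t s u ^+ n.
Proof. exact: rmorphXn. Qed.

Lemma evalXY1 t s : evalXY t s 1 = 1.
Proof. exact: rmorph1. Qed.

Lemma evalXYE t s u : evalXY t s u = \sum_(i < size u) evalX t u`_i * s ^+ i.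
Proof.
rewrite evalXY.unlock (@horner_coef_wide _ (size u)) ?size_poly //.
by apply: eq_bigr => i _; rewrite coef_map.
Qed.

Lemma eval_inE u t s : eval_in iota u s t = evalXY t s u.
Proof.
rewrite /eval_in evalXY.unlock.
have -> : map_poly (evalX t) u = map_poly (horner_eval t) (map_poly (map_poly iota) u).
  by rewrite -map_poly_comp; apply: eq_map_poly => p; rewrite evalX.unlock.
have E : s = horner_eval t s%:P by rewrite /horner_eval hornerC.
by rewrite [in RHS]E horner_map.
Qed.

Record subfield_pred (F : L -> Prop) : Prop := SubfieldPred {
  subfield_const : forall c, F (iota c);
  subfield_sub : forall z w, F z -> F w -> F (z - w);
  subfield_mul : forall z w, F z -> F w -> F (z * w);
  subfield_inv : forall z, F z -> F z^-1
}.

(** Quantifying over subfields makes it easy to pass from one pair of generators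
    to another. *)
Definition generate (t s : L) :=
  forall F, subfield_pred F -> F t -> F s -> forall z, F z.

Lemma subfield0 F : subfield_pred F -> F 0.
Proof. by case=> F_const _ _ _; rewrite -(rmorph0 iota). Qed.

Lemma subfield_add F : subfield_pred F -> forall z w, F z -> F w -> F (z + w).
Proof.
move=> F_sf z w Fz Fw; rewrite -[w]opprK; apply: (subfield_sub F_sf) => //.
by rewrite -sub0r; apply: (subfield_sub F_sf) => //; apply: subfield0.
Qed.

Lemma subfield_exp F : subfield_pred F -> forall z n, F z -> F (z ^+ n).
Proof.
move=> F_sf z n Fz; elim: n => [|n IHn].
  by rewrite expr0 -(rmorph1 iota); apply: (subfield_const F_sf).
by rewrite exprS; apply: (subfield_mul F_sf).
Qed.

Lemma subfield_evalX F t p : subfield_pred F -> F t -> F (evalX t p).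
Proof.
move=> F_sf Ft; elim/poly_ind: p => [|p c IHp].
  by rewrite rmorph0; apply: subfield0.
rewrite rmorphD rmorphM /= evalX_X evalX_C; apply: subfield_add => //.
  by apply: (subfield_mul F_sf).
exact: (subfield_const F_sf).
Qed.

Lemma subfield_evalXY F t s u : subfield_pred F -> F t -> F s -> F (evalXY t s u).
Proof.
move=> F_sf Ft Fs; elim/poly_ind: u => [|u p IHu].
  by rewrite rmorph0; apply: subfield0.
rewrite rmorphD rmorphM /= evalXY_X evalXY_C; apply: subfield_add => //.
  by apply: (subfield_mul F_sf).
exact: subfield_evalX.
Qed.

Lemma function_field_generate f x y : is_function_field iota f x y -> generate x y.
Proof.
case=> _ gen F F_sf Fx Fy z; have [u [w [_ ->]]] := gen z.
rewrite !eval_inE; apply: (subfield_mul F_sf); first exact: subfield_evalXY.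
by apply: (subfield_inv F_sf); apply: subfield_evalXY.
Qed.

Lemma generate_frac t s : generate t s ->
  forall z, exists u w, evalXY t s w != 0 /\ z = evalXY t s u / evalXY t s w.
Proof.
move=> gen; apply: gen; first split.
- by move=> c; exists c%:P%:P, 1; rewrite rmorph1 divr1 evalXY_C evalX_C oner_eq0.
- move=> _ _ [u [w [w0 ->]]] [u' [w' [w'0 ->]]].
  exists (u * w' - u' * w), (w * w').
  rewrite rmorphB !rmorphM /= mulf_neq0 //; split=> //.
  by field; rewrite w0 w'0.
- move=> _ _ [u [w [w0 ->]]] [u' [w' [w'0 ->]]]; exists (u * u'), (w * w').
  by rewrite !rmorphM /= mulf_neq0 // mulf_div.
- move=> _ [u [w [w0 ->]]]; have [u0|u0] := eqVneq (evalXY t s u) 0.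
    by exists 0, 1; rewrite u0 rmorph0 rmorph1 !mul0r invr0 oner_eq0.
  by exists w, u; rewrite invf_div.
- by exists 'X%:P, 1; rewrite rmorph1 divr1 evalXY_C evalX_X oner_eq0.
- by exists 'X, 1; rewrite rmorph1 divr1 evalXY_X oner_eq0.
Qed.

End Evaluation.

(** * Totally ramified points of Kummer extensions *)

Section KummerExtension.

Variables (K L : fieldType) (iota : {rmorphism K -> L}) (t s : L).
Variables (d : nat) (g : {poly K}).

Local Notation h := (evalX iota t).
Local Notation ev := (evalXY iota t s).

Hypothesis d_gt0 : (0 < d)%N.
Hypothesis sd : s ^+ d = h g.
Hypothesis t_trans : forall p, h p = 0 -> p = 0.
Hypothesis ts_gen : generate iota t s.

Lemma ev_integral u : integralOver h (ev u).
Proof.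
have s_int : integralOver h s.
  exists ('X^d - g%:P); first by rewrite monicXnsubC.
  by rewrite rmorphB /= map_polyXn map_polyC /root !hornerE sd subrr.
rewrite evalXY.unlock; apply: integral_horner => //; apply/integral_poly => i.
rewrite coef_map.
exact: integral_id.
Qed.

(** An integral element divides the constant term of its equation: this plays
    the part of the norm to [K[t]]. *)
Lemma ev_dvd_evalX u : ev u != 0 -> exists w a, a != 0 /\ ev u * ev w = h a.
Proof.
move=> u0; have [p p_monic] := ev_integral u.
have [m [q]] := multiplicity_XsubC p 0.
rewrite monic_neq0 //= subr0 => q0 ->.
rewrite rmorphM rootM /= map_polyXn => /orP[]; last first.
  by rewrite /root hornerXn expf_eq0 (negPf u0) andbF.
have [r qE] : exists r, q = r * 'X + q.[0]%:P.
  have /factor_theorem[r] : root (q - q.[0]%:P) 0 by rewrite /root !hornerE subrr.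
  by rewrite subr0 => /(canRL (subrK _)) qE; exists r.
rewrite {1}qE rmorphD rmorphM /= map_polyX map_polyC /root !hornerE /= => /eqP E.
exists ((map_poly polyC r).[u]), (- q.[0]); split.
  by rewrite oppr_eq0.
have -> : ev (map_poly polyC r).[u] = (map_poly h r).[ev u].
  rewrite -horner_map -map_poly_comp; congr (_.[_]).
  by apply: eq_map_poly => c; exact: evalXY_C.
by apply/eqP; rewrite (rmorphN h) -addr_eq0 mulrC E.
Qed.

Lemma ev_reduce u : exists q w : {poly {poly K}},
  [/\ (size w <= d)%N, u = q * ('X^d - g%:P) + w & ev w = ev u].
Proof.
set f : {poly {poly K}} := 'X^d - g%:P.
have f_monic : f \is monic by apply: monicXnsubC.
have uE := Pdiv.RingMonic.rdivp_eq f_monic u.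
exists (Pdiv.Ring.rdivp u f), (Pdiv.Ring.rmodp u f); split=> //.
  by rewrite -ltnS -(size_XnsubC g d_gt0) Pdiv.Ring.ltn_rmodpN0 ?monic_neq0.
rewrite {2}uE evalXYD evalXYM evalXYB evalXYX.
by rewrite evalXY_X evalXY_C sd subrr mulr0 add0r.
Qed.

Section RamifiedPlace.

Variables (a : K) (g1 : {poly K}).
Hypothesis gE : g = ('X - a%:P) * g1.
Hypothesis g1a : g1.[a] != 0.

Let rho (u : {poly {poly K}}) := u.[0].[a].
(** The functions in [K[t, s]] that vanish at the point [t = a], [s = 0]. *)
Let m z := exists2 u, z = ev u & rho u = 0.

Let rhoE u : rho u = 0 -> exists p w, u = ('X - a%:P)%:P * p%:P + 'X * w.
Proof.
move=> /eqP/factor_theorem[p pE].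
have /factor_theorem[w] : root (u - u.[0]%:P) 0 by rewrite /root !hornerE subrr.
rewrite subr0 => /(canRL (subrK _)) uE; exists p, w.
by rewrite [LHS]uE addrC pE mulrC polyCM (mulrC w).
Qed.

Let ta : L := t - iota a.

Let sd' : s ^+ d = ta * h g1.
Proof. by rewrite sd gE rmorphM /= evalX_XsubC. Qed.

(** Otherwise [t - a] would be a unit of the integral extension [K[t, s]] of
    [K[t]], hence of the integrally closed ring [K[t]] itself. *)
Let m_proper : ~ m 1.
Proof.
move=> [u E /rhoE[p [w uE]]].
have ta0 : ta != 0.
  apply/eqP => ta0; have := @t_trans ('X - a%:P).
  by rewrite evalX_XsubC -/ta ta0 => /(_ erefl)/eqP; rewrite polyXsubC_eq0.
have [q qE] : exists q, ta * ev q = 1.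
  (* [1 = ta h(p) + s ev(w)]; raising [1 - ta h(p) = s ev(w)] to the power [d]
     makes [ta] divide both sides. *)
  have E1 : (1 - ta * h p) ^+ d = ta * h g1 * ev w ^+ d.
    rewrite -sd' -exprMn; congr (_ ^+ _); rewrite {1}E uE rmorphD !rmorphM /=.
    by rewrite !evalXY_C evalXY_X evalX_XsubC -/ta; ring.
  exists (g1%:P * w ^+ d + p%:P * \sum_(i < d) (1 - ('X - a%:P)%:P * p%:P) ^+ i).
  rewrite rmorphD !rmorphM rmorphXn rmorph_sum /= !evalXY_C mulrDr !mulrA -E1.
  have -> : \sum_(i < d) ev ((1 - ('X - a%:P)%:P * p%:P) ^+ i)
           = \sum_(i < d) (1 - ta * h p) ^+ i.
    apply: eq_bigr => i _; rewrite rmorphXn rmorphB rmorphM rmorph1 /= !evalXY_C.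
    by rewrite evalX_XsubC.
  have := subrX1 (1 - ta * h p) d.
  rewrite addrAC subrr add0r mulNr => /(canRL (subrK _)) ->; ring.
(* Multiply the equation of [1 / ta] by a power of [ta] and put [t = a]. *)
have [r r_monic /rootP rq] := ev_integral q.
pose n := (size r).-1.
have n_size : size r = n.+1 by rewrite prednK // size_poly_gt0 monic_neq0.
have /(congr1 (fun p => p.[a])) : \sum_(i < n.+1) r`_i * ('X - a%:P) ^+ (n - i) = 0.
  have rq' : \sum_(i < n.+1) h r`_i * ev q ^+ i = 0.
    rewrite -[RHS]rq (@horner_coef_wide _ n.+1) -?n_size ?size_poly //.
    by apply: eq_bigr => i _; rewrite coef_map.
  apply: t_trans; rewrite rmorph_sum.
  transitivity (ta ^+ n * \sum_(i < n.+1) h r`_i * ev q ^+ i); last first.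
    by rewrite rq' mulr0.
  rewrite mulr_sumr.
  apply: eq_bigr => i _; rewrite rmorphM rmorphXn /= evalX_XsubC.
  have i_n : (i <= n)%N by rewrite -ltnS.
  have -> : ta ^+ n = ta ^+ (n - i) * ta ^+ i by rewrite -exprD subnK.
  by rewrite mulrACA -exprMn qE expr1n mulr1 mulrC.
rewrite horner_sum big_ord_recr /= subnn expr0 mulr1 big1 ?add0r => [|i _].
  have := monicP r_monic; rewrite lead_coefE -/n => ->.
  by rewrite !hornerE => /eqP; rewrite oner_eq0.
rewrite hornerM horner_exp !hornerE subrr expr0n subn_eq0 leqNgt ltn_ord.
by rewrite mulr0.
Qed.

Let rho_ev u w : ev u = ev w -> rho u = rho w.
Proof.
move=> E; apply/eqP; rewrite -subr_eq0; apply: contra_notT m_proper => c0.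
exists (1 - (u - w) * ((rho u - rho w)^-1)%:P%:P).
  by rewrite evalXYB evalXYM [ev (u - w)]evalXYB E subrr mul0r subr0 evalXY1.
by rewrite /rho !hornerE mulfV ?subrr.
Qed.

Let mP u : m (ev u) <-> rho u = 0.
Proof. by split=> [[w /rho_ev ->]|u0] //; exists u. Qed.

(** Where [g] has a simple zero [a] the extension is totally ramified, and [s]
    is a uniformizer at the unique place above [a]. *)
Lemma ramified_place : exists P : place iota,
  [/\ ord_at P s = 1, ord_at P (t - iota a) = d%:Z & rational_point P].
Proof.
have s0 : s != 0.
  apply/eqP => s0; have := @t_trans g; rewrite -sd s0 expr0n gtn_eqF //.
  move=> /(_ erefl)/eqP; rewrite gE mulf_eq0 polyXsubC_eq0 /= => /eqP g10.
  by move: g1a; rewrite g10 horner0 eqxx.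
pose A z := exists u, z = ev u.
have A_ev u : A (ev u) by exists u.
have Ah p : A (h p) by rewrite -(evalXY_C iota t s); apply: A_ev.
have g1m : ~ m (h g1).
  rewrite -(evalXY_C iota t s) mP /rho hornerC; exact/eqP.
have mh p : m (h p) <-> p.[a] = 0 by rewrite -(evalXY_C iota t s) mP /rho hornerC.
case: (@dvr_place _ _ iota A m _ _ _ _ _ _ _ m_proper s) => //.
- by move=> c; exists c%:P%:P; rewrite evalXY_C evalX_C.
- by move=> _ _ [u ->] [w ->]; rewrite -evalXYB.
- by move=> _ _ [u ->] [w ->]; rewrite -evalXYM.
- move=> z; have [u [w [w0 zE]]] := generate_frac ts_gen z.
  by exists (ev u), (ev w).
- move=> _ _ [u -> u0] [w -> w0]; rewrite -evalXYB mP.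
  by move: u0 w0; rewrite /rho !hornerE => -> ->; rewrite subrr.
- move=> _ _ [u ->] [w -> w0]; rewrite -evalXYM mP.
  by move: w0; rewrite /rho !hornerE => ->; rewrite mulr0.
- move=> _ _ [u ->] [w ->]; rewrite -evalXYM !mP /rho !hornerE => /eqP.
  by rewrite mulf_eq0 => /orP[]/eqP; [left|right].
- by rewrite -(evalXY_X iota t s); apply: A_ev.
- by rewrite -(evalXY_X iota t s) mP /rho !hornerE.
- (* [g1(t)] is a unit at the point and [ta g1(t) = s^d], so [s] generates. *)
  move=> _ [u ->] /mP /rhoE[p [w uE]].
  exists (h g1), (s ^+ d.-1 * h p + h g1 * ev w); split=> //.
    exists ('X ^+ d.-1 * p%:P + g1%:P * w).
    by rewrite evalXYD !evalXYM evalXYX !evalXY_C evalXY_X.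
  rewrite uE evalXYD !evalXYM !evalXY_C evalXY_X evalX_XsubC -/ta.
  rewrite !mulrDr !mulrA -exprS prednK // sd'; ring.
- move=> _ [u ->] u0; have [w [b [b0 bE]]] := ev_dvd_evalX u0.
  have [j [b1]] := multiplicity_XsubC b a; rewrite b0 /= => b1a bE'.
  (* [u] divides [b(t)], whose order is [d j]. *)
  exists (d * j).+1 => _ _ [lam ->] nlam [r ->] E.
  have E' : ev lam * h b1 = s * (ev r * ev w * h g1 ^+ j).
    apply: (@mulfI _ (s ^+ (d * j))); first by rewrite expf_neq0.
    have -> : s ^+ (d * j) * (ev lam * h b1) = ev lam * h b * h g1 ^+ j.
      by rewrite exprM sd' bE' rmorphM rmorphXn /= evalX_XsubC -/ta exprMn; ring.
    rewrite -bE mulrA E exprSr; ring.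
  have : m (ev lam * h b1).
    exists ('X * (r * w * g1%:P ^+ j)); last first.
      by rewrite /rho hornerM hornerX mul0r horner0.
    by rewrite E' !evalXYM evalXYX evalXY_X evalXY_C.
  rewrite -(evalXY_C iota t s b1) -evalXYM mP /rho !hornerE => /eqP.
  rewrite mulf_eq0 => /orP[/eqP/mP //|].
  by rewrite -[_ == _]/(root b1 a) (negPf b1a).
move=> P [vs vu _ vm vrep]; exists P.
have vh p : p.[a] != 0 -> ord_at P (h p) = 0.
  by move=> pa; apply: vu => //; rewrite mh; exact/eqP.
split=> //.
- have ta0 : ta != 0.
    apply: contra_neq s0 => ta0; have /eqP : s ^+ d = 0 by rewrite sd' ta0 mul0r.
    by rewrite expf_eq0 => /andP[_ /eqP].
  have hg1 : h g1 != 0.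
    by apply: contra_notN g1m => /eqP->; rewrite -(rmorph0 ev) mP /rho !horner0.
  by have := congr1 (ord_at P) sd'; rewrite ordX vs ord_mul // vh // addr0 => <-; lia.
move=> z z0 zge; have [_ [_ [[u ->] [w ->] /mP/eqP nw zE]]] := vrep z z0 zge.
exists (rho u / rho w).
have w0 : ev w != 0.
  apply: contra_neq nw => w0; apply/mP; rewrite w0.
  by exists 0; rewrite ?rmorph0 // /rho !horner0.
have E : z - iota (rho u / rho w) = ev (u - w * (rho u / rho w)%:P%:P) / ev w.
  by rewrite evalXYB evalXYM evalXY_C evalX_C {1}zE mulrBl mulrAC mulfV // mul1r.
have [e0|e0] := eqVneq (ev (u - w * (rho u / rho w)%:P%:P)) 0.
  by left; apply/eqP; rewrite -subr_eq0 E e0 mul0r.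
right; rewrite E ord_mul ?invr_eq0 // ordV (vu (ev w)) ?oppr0 ?addr0 //; last first.
  by move/mP/eqP; apply/negP.
apply: vm => //; apply/mP.
have -> : rho (u - w * (rho u / rho w)%:P%:P) = rho u - rho w * (rho u / rho w).
  by rewrite [LHS]/rho !hornerE.
by rewrite mulrC divfK ?subrr.
Qed.

End RamifiedPlace.

End KummerExtension.

(** * Unramified points of Kummer extensions *)

Lemma irreducible_dvdM (F : fieldType) (p u w : {poly F}) :
  irreducible_poly p -> p %| u * w -> (p %| u) || (p %| w).
Proof.
move=> p_irr; have [//|npu] := boolP (p %| u); rewrite Gauss_dvdpr //.
by rewrite irreducible_poly_coprime.
Qed.

Lemma irreducible_factor (F : fieldType) (p : {poly F}) : (1 < size p)%N ->
  exists2 q, irreducible_poly q & q %| p.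
Proof.
have [n] := ubnP (size p); elim: n p => // n IHn p; rewrite ltnS => pn p1.
have [[q [q1 qp nqp]]|H] := EM (exists q : {poly F},
    [/\ size q != 1%N, q %| p & ~~ (q %= p)]).
  have p0 : p != 0 by rewrite -size_poly_gt0 ltnW.
  have q0 : q != 0 by apply: contraNneq p0 => q0; move: qp; rewrite q0 dvd0p.
  have q_gt1 : (1 < size q)%N by rewrite ltn_neqAle eq_sym q1 size_poly_gt0.
  have qlt : (size q < size p)%N.
    rewrite ltn_neqAle dvdp_leq // andbT; apply: contra nqp => /eqP E.
    by rewrite -dvdp_size_eqp ?E.
  have [r r_irr rq] := IHn q (leq_trans qlt pn) q_gt1.
  by exists r => //; apply: dvdp_trans rq qp.
exists p => //; split=> // q q1 qp; apply: contra_notT H => nqp.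
by exists q.
Qed.

Lemma separable_XnsubC (F : fieldType) (n : nat) (c : F) :
  n%:R != 0 :> F -> c != 0 -> separable_poly ('X^n - c%:P).
Proof.
case: n => [|n] n0 c0; first by rewrite eqxx in n0.
rewrite unlock; apply/Bezout_eq1_coprimepP.
exists (- (c^-1)%:P, (c^-1 * n.+1%:R^-1)%:P * 'X).
rewrite /= derivB derivXn derivC subr0 /=.
have -> : 'X^n *+ n.+1 = n.+1%:R%:P * 'X^n :> {poly F} by rewrite polyC_natr mulr_natl.
rewrite polyCM mulNr mulrBr -(polyCM c^-1 c) mulVf // opprB exprS.
have -> : (c^-1)%:P * (n.+1%:R^-1)%:P * 'X * (n.+1%:R%:P * 'X^n) =
   (c^-1)%:P * ('X * 'X^n) * (n.+1%:R^-1 * n.+1%:R)%:P :> {poly F}.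
  by rewrite polyCM; ring.
by rewrite mulVf // mulr1 subrK polyC1.
Qed.

(** A nonzero polynomial of degree less than [n] is coprime to some simple
    irreducible factor of [X^n - c]. *)
Lemma separating_factor (F : fieldType) (n : nat) (c : F) (u : {poly F}) :
    n%:R != 0 :> F -> c != 0 -> u != 0 -> (size u <= n)%N ->
  exists D l, [/\ irreducible_poly D, 'X^n - c%:P = D * l, ~~ (D %| l)
    & ~~ (D %| u)].
Proof.
move=> n0 c0 u0 u_n; have sep := separable_XnsubC n0 c0.
have n_gt0 : (0 < n)%N by rewrite lt0n; apply: contraNneq n0 => ->.
set f := 'X^n - c%:P in sep *.
have f0 : f != 0 by rewrite -size_poly_gt0 size_XnsubC.
have fE : f = (f %/ gcdp f u) * gcdp f u by rewrite divpK // dvdp_gcdl.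
have g_size : (size (gcdp f u) <= n)%N.
  by apply: leq_trans u_n; apply: dvdp_leq => //; apply: dvdp_gcdr.
have [D D_irr Dq] : exists2 D, irreducible_poly D & D %| f %/ gcdp f u.
  apply: irreducible_factor; rewrite size_divp ?gcdp_eq0 ?negb_and ?f0 //.
  have -> : size f = n.+1 by exact: size_XnsubC.
  have : (0 < size (gcdp f u))%N by rewrite size_poly_gt0 gcdp_eq0 (negPf f0).
  by move: g_size; case: size => // k; lia.
have D_size : (1 < size D)%N by case: D_irr.
have Ndvd1 q : D %| q -> ~~ coprimep D q.
  move=> Dq'; rewrite /coprimep gtn_eqF //.
  apply: leq_trans D_size _; apply: dvdp_leq; last by rewrite dvdp_gcd dvdpp.
  by rewrite gcdp_eq0 negb_and irredp_neq0.
have Df : D %| f by rewrite fE dvdp_mulr.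
exists D, (f %/ D); split=> //; first by rewrite mulrC divpK.
  apply/negP => /Ndvd1/negP[]; apply: (separable_coprime sep).
  by rewrite mulrC divpK.
apply/negP => Du; have Dg : D %| gcdp f u by rewrite dvdp_gcd Df.
move/Ndvd1/negP: (Dg); apply; apply: (separable_coprime sep).
by rewrite [X in _ %| X]fE dvdp_mul.
Qed.

Lemma dvd_polyC_coef (K : fieldType) (p : {poly K}) (u : {poly {poly K}}) :
  (forall i, p %| u`_i) -> exists w, u = p%:P * w.
Proof.
elim/poly_ind: u => [|u c IHu] pu; first by exists 0; rewrite mulr0.
have [i|w ->] := IHu.
  by have := pu i.+1; rewrite -cons_poly_def coef_cons.
have /dvdpP[q ->] : p %| c by have := pu 0%N; rewrite -cons_poly_def coef_cons.
by exists (w * 'X + q%:P); rewrite mulrDr mulrA polyCM [p%:P * q%:P]mulrC.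
Qed.

Section UnramifiedPlace.

Variables (K L : fieldType) (iota : {rmorphism K -> L}) (t s : L).
Variables (d : nat) (g : {poly K}).

Local Notation h := (evalX iota t).
Local Notation ev := (evalXY iota t s).

Hypothesis d_gt0 : (0 < d)%N.
Hypothesis sd : s ^+ d = h g.
Hypothesis t_trans : forall p, h p = 0 -> p = 0.
Hypothesis ts_gen : generate iota t s.
Hypothesis s_free : forall u : {poly {poly K}}, (size u <= d)%N -> ev u = 0 -> u = 0.

(** [kappa], with the projection [r], is the residue field of [K[X]] at the
    prime [pi]. *)
Variables (kappa : fieldType) (r : {rmorphism {poly K} -> kappa}) (pi : {poly K}).
Hypothesis pi_size : (1 < size pi)%N.
Hypothesis r_surj : forall c, exists p, r p = c.
Hypothesis r_ker : forall p, r p = 0 <-> pi %| p.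

Let r_pi : r pi = 0.
Proof. exact/r_ker. Qed.

Let lift (q : {poly kappa}) : exists u, map_poly r u = q.
Proof.
elim/poly_ind: q => [|q c [u <-]]; first by exists 0; rewrite rmorph0.
have [p <-] := r_surj c.
by exists (u * 'X + p%:P); rewrite rmorphD rmorphM /= map_polyX map_polyC.
Qed.

Let map_r_eq0 u : map_poly r u = 0 -> exists w, u = pi%:P * w.
Proof.
move=> u0; apply: dvd_polyC_coef => i; apply/r_ker.
by rewrite -coef_map u0 coef0.
Qed.

Let pi_part b : b != 0 -> exists j b', b = pi ^+ j * b' /\ r b' != 0.
Proof.
have [n] := ubnP (size b); elim: n b => // n IHn b; rewrite ltnS => bn b0.
have [rb|rb] := eqVneq (r b) 0; last by exists 0%N, b; rewrite expr0 mul1r.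
have /dvdpP[q bE] := (r_ker b).1 rb.
have q0 : q != 0 by apply: contraNneq b0 => q0; rewrite bE q0 mul0r.
have pi0 : pi != 0 by rewrite -size_poly_gt0 ltnW.
have [|j [b' [qE rb']]] := IHn q _ q0.
  by apply: leq_trans bn; rewrite bE size_mul // -subn1 ltn_subRL addnC ltn_add2l.
by exists j.+1, b'; split=> //; rewrite bE qE exprS; ring.
Qed.

Variables (D l : {poly kappa}).
Hypothesis D_irr : irreducible_poly D.
Hypothesis fE : 'X^d - (r g)%:P = D * l.
Hypothesis Dl : ~~ (D %| l).

(** The functions in [K[t, s]] that vanish at the point over [pi] where [s] is a
    root of [D]. *)
Let m z := exists2 u, z = ev u & D %| map_poly r u.

Let ev0_dvd u : ev u = 0 -> D %| map_poly r u.
Proof.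
move=> u0; have [q [w [w_d uE wE]]] := ev_reduce d_gt0 sd u.
have w0 : w = 0 by apply: (s_free w_d); rewrite wE.
rewrite uE w0 addr0 rmorphM rmorphB /= map_polyXn map_polyC /= fE.
by rewrite mulrCA dvdp_mulr.
Qed.

Let mP u : m (ev u) <-> D %| map_poly r u.
Proof.
split=> [[w E Dw]|]; last by exists u.
rewrite -[u](subrK w) rmorphD dvdp_addl //; apply: ev0_dvd.
by rewrite evalXYB E subrr.
Qed.

(** If [D] divides [u] modulo [pi], then [l u] is a multiple of [X^d - g] modulo
    [pi], hence [l u] is a multiple of [pi] in [K[t, s]]; and [l] is a unit at
    the point because [D] is a simple factor. So [pi] is a uniformizer. *)
Lemma unramified_place : exists P : place iota,
  [/\ forall u, ~~ (D %| map_poly r u) -> ord_at P (ev u) = 0,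
      forall u, ord_ge P 0 (ev u)
    & forall b, b != 0 -> r b = 0 -> 0 < ord_at P (h b)].
Proof.
pose A z := exists u, z = ev u.
have A_ev u : A (ev u) by exists u.
have hC p : h p = ev p%:P by rewrite evalXY_C.
have D1 : (1 < size D)%N by case: D_irr.
have mh p : m (h p) <-> r p = 0.
  rewrite hC mP map_polyC /=; split=> [|->]; last by rewrite rmorph0 dvdp0.
  apply: contraPeq => rp; apply/negP.
  by rewrite gtNdvdp ?polyC_eq0 // size_polyC rp.
have m1 : ~ m 1 by rewrite -(rmorph1 h) mh rmorph1; apply/eqP/oner_neq0.
have pi0 : h pi != 0.
  apply/eqP => /t_trans pi0; by move: pi_size; rewrite pi0 size_poly0.
case: (@dvr_place _ _ iota A m _ _ _ _ _ _ _ m1 (h pi)) => //.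
- by move=> c; exists c%:P%:P; rewrite evalXY_C evalX_C.
- by move=> _ _ [u ->] [w ->]; rewrite -evalXYB.
- by move=> _ _ [u ->] [w ->]; rewrite -evalXYM.
- move=> z; have [u [w [w0 zE]]] := generate_frac ts_gen z.
  by exists (ev u), (ev w).
- move=> _ _ [u -> Du] [w -> Dw]; rewrite -evalXYB mP rmorphB.
  by rewrite dvdp_sub.
- by move=> _ _ [u ->] [w -> Dw]; rewrite -evalXYM mP rmorphM dvdp_mull.
- move=> _ _ [u ->] [w ->]; rewrite -evalXYM !mP rmorphM.
  by move=> /(irreducible_dvdM D_irr)/orP[]; [left|right].
- by rewrite hC; apply: A_ev.
- by rewrite mh.
- move=> _ [u ->] /mP /dvdpP[n uE].
  have [la laE] := lift l; have [nu nuE] := lift n.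
  have [w wE] : exists w, la * u - nu * ('X^d - g%:P) = pi%:P * w.
    apply: map_r_eq0; rewrite rmorphB !rmorphM rmorphB /= map_polyXn map_polyC /=.
    by rewrite fE laE nuE uE; ring.
  exists (ev la), (ev w); split=> //; first by rewrite mP laE; exact/negP.
  rewrite -evalXYM hC -evalXYM -wE evalXYB [X in _ - X]evalXYM.
  by rewrite evalXYB evalXYX evalXY_X evalXY_C sd subrr mulr0 subr0.
- move=> _ [u ->] u0; have [w [b [b0 bE]]] := ev_dvd_evalX d_gt0 sd u0.
  have [j [b' [bE' rb']]] := pi_part b0.
  exists j.+1 => _ _ [lam ->] nlam [q ->] E.
  have E' : ev lam * h b' = h pi * (ev q * ev w).
    apply: (@mulfI _ (h pi ^+ j)); first by rewrite expf_neq0.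
    have -> : h pi ^+ j * (ev lam * h b') = ev lam * h b.
      by rewrite bE' rmorphM rmorphXn /=; ring.
    rewrite -bE mulrA E exprSr; ring.
  have : m (ev lam * h b').
    rewrite E' hC -!evalXYM mP rmorphM /= map_polyC /= r_pi rmorph0 mul0r.
    exact: dvdp0.
  rewrite {1}hC -evalXYM mP rmorphM => /(irreducible_dvdM D_irr)/orP[/mP //|].
  by rewrite -mP -hC mh; exact/eqP.
move=> P [_ vu vA vm _]; exists P; split.
- by move=> u Du; apply: vu => //; rewrite mP; exact/negP.
- by move=> u; rewrite /ord_ge; have [//|u0] := eqVneq (ev u) 0; rewrite vA.
move=> b b0 rb; apply: vm; [by rewrite hC; apply: A_ev| |by rewrite mh].
by apply: contra_neq b0; apply: t_trans.
Qed.

End UnramifiedPlace.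

(** * Functions without finite poles *)

Definition regular_finite (K L : fieldType) (iota : {rmorphism K -> L}) (t z : L) :=
  forall P : place iota, ord_ge P 0 t -> ord_ge P 0 z.

Section ClearDenominator.

Variables (K L : fieldType) (iota : {rmorphism K -> L}) (t s : L).
Variables (d : nat) (g : {poly K}).

Local Notation h := (evalX iota t).
Local Notation ev := (evalXY iota t s).

Hypothesis d_gt0 : (0 < d)%N.
Hypothesis dK : d%:R != 0 :> K.
Hypothesis sd : s ^+ d = h g.
Hypothesis t_trans : forall p, h p = 0 -> p = 0.
Hypothesis ts_gen : generate iota t s.
Hypothesis s_free : forall u : {poly {poly K}}, (size u <= d)%N -> ev u = 0 -> u = 0.

(** An unramified prime [pi] cancels from the denominator of a function without
    finite poles: a numerator that is nonzero modulo [pi] would be nonzero at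
    one of the points above [pi], by [separating_factor], and the function would
    have a pole there. *)
Lemma regular_unramified (z : L) (pi a : {poly K}) (u : {poly {poly K}}) :
    irreducible_poly pi -> ~~ (pi %| g) -> a != 0 -> pi %| a ->
    (size u <= d)%N -> h a * z = ev u -> regular_finite iota t z ->
  exists w, u = pi%:P * w.
Proof.
wlog pi_monic : pi / pi \is monic => [IH pi_irr pi_g a0 pi_a u_d zE z_reg|].
  have pi0 := irredp_neq0 pi_irr.
  pose c := (lead_coef pi)^-1; have c0 : c != 0 by rewrite invr_eq0 lead_coef_eq0.
  have E : c *: pi %= pi by rewrite eqp_scale.
  have [||||w ->] := IH (c *: pi) _ _ _ a0 _ u_d zE z_reg.
  - by rewrite monicE lead_coefZ mulVf // lead_coef_eq0.
  - case: pi_irr => pi1 pi_irr; split=> [|q q1]; first by rewrite size_scale.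
    by rewrite dvdpZr // => /(pi_irr q q1) /eqp_trans; apply; rewrite eqp_sym.
  - by rewrite dvdpZl.
  - by rewrite dvdpZl.
  by exists (c%:P%:P * w); rewrite -mul_polyC polyCM; ring.
move=> pi_irr pi_g a0 pi_a u_d zE z_reg.
have mi : monic_irreducible_poly pi by [].
pose kappa := {poly %/ pi with mi} : fieldType.
pose r : {rmorphism {poly K} -> kappa} := in_qpoly pi.
have r_ker p : r p = 0 <-> pi %| p.
  have E : val (r p) = Pdiv.Ring.rmodp p pi by rewrite /r /= (mk_monicE mi).
  rewrite Pdiv.Field.dvdpE /Pdiv.Ring.rdvdp -E.
  by split=> [->//|/eqP rp]; apply: val_inj.
have pi_size : (1 < size pi)%N by case: pi_irr.
have r_surj c : exists p, r p = c.
  exists (val (c : {poly %/ pi})); apply: val_inj; apply: in_qpoly_small.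
  exact: size_mk_monic.
have [ru0|ru0] := eqVneq (map_poly r u) 0.
  apply: dvd_polyC_coef => i; apply/r_ker.
  by rewrite -coef_map ru0 coef0.
have dk : d%:R != 0 :> kappa.
  rewrite -(rmorph_nat r) -polyC_natr; apply/eqP => /r_ker.
  by rewrite gtNdvdp ?polyC_eq0 // size_polyC dK.
have rg : r g != 0 by apply: contraNneq pi_g => /r_ker.
have [|D [l [D_irr fE Dl Du]]] := separating_factor dk rg ru0 (n := d).
  by apply: leq_trans (size_poly _ _) u_d.
have [P [vu vge va]] :=
  unramified_place d_gt0 sd t_trans ts_gen s_free pi_size r_surj r_ker D_irr fE Dl.
have u0 : ev u != 0.
  by apply: contra_neq ru0 => /(s_free u_d)->; rewrite rmorph0.
have [ha0 z0] : h a != 0 /\ z != 0.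
  by apply/andP; rewrite -negb_or -mulf_eq0 zE.
have tP : ord_ge P 0 t by rewrite -(evalX_X iota t) -(evalXY_C iota t s).
have := z_reg P tP; rewrite ord_ge_neq0 // => vz.
have /(congr1 (ord_at P)) := zE; rewrite ord_mul // vu //.
by move/eqP; rewrite gt_eqF // ltr_pwDl // va //; exact/r_ker.
Qed.

End ClearDenominator.

(** * Orders of polynomials *)

Lemma mulrnZ (x : int) n : x *+ n = x * n%:Z.
Proof. by rewrite -mulr_natr natz. Qed.

Section OrdEvalX.

Variables (K L : fieldType) (iota : {rmorphism K -> L}) (P : place iota) (t : L).

Local Notation v := (ord_at P).
Local Notation h := (evalX iota t).

Lemma ord_ge_evalX p : ord_ge P 0 t -> ord_ge P 0 (h p).
Proof.
move=> t0; elim/poly_ind: p => [|p c IHp]; first by rewrite rmorph0 ord_ge0.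
rewrite rmorphD rmorphM /= evalX_X evalX_C ord_geD ?ord_ge_const //.
by rewrite -(addr0 0) ord_geM.
Qed.

Lemma ord_evalX_nonroot (a : K) p :
  0 < v (t - iota a) -> ~~ root p a -> h p != 0 /\ v (h p) = 0.
Proof.
move=> ta pa; have ta0 : t - iota a != 0.
  by apply: contraTneq ta => ->; rewrite ord_at0.
have t0 : ord_ge P 0 t.
  by rewrite -(subrK (iota a) t) ord_geD ?ord_ge_const // ord_ge_neq0 // ltW.
have /factor_theorem[q pE] : root (p - p.[a]%:P) a by rewrite /root !hornerE subrr.
have c0 : iota p.[a] != 0 by rewrite fmorph_eq0.
have -> : h p = iota p.[a] + h q * (t - iota a).
  rewrite -evalX_XsubC -rmorphM -pE rmorphB /= evalX_C; ring.
have := @ordD_lt _ _ _ P (iota p.[a]) (h q * (t - iota a)) c0.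
rewrite ord_const0; apply; rewrite ord_geM ?ord_ge_evalX //.
by rewrite ord_ge_neq0.
Qed.

Lemma ord_evalX_root (a : K) p : 0 < v (t - iota a) -> p != 0 ->
  h p != 0 /\ v (h p) = v (t - iota a) *+ mup a p.
Proof.
move=> ta p0; have [m [q]] := multiplicity_XsubC p a.
rewrite p0 /= => qa pE; have [hq0 vq] := ord_evalX_nonroot ta qa.
have ta0 : t - iota a != 0 by apply: contraTneq ta => ->; rewrite ord_at0.
rewrite pE mupMr // mup_XsubCX eqxx rmorphM rmorphXn /= evalX_XsubC.
by rewrite mulf_neq0 ?expf_neq0 // ord_mul ?expf_neq0 // vq add0r ordX.
Qed.

Lemma ord_evalX_pole p : v t < 0 -> p != 0 ->
  h p != 0 /\ v (h p) = v t *+ (size p).-1.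
Proof.
move=> t_lt0; have t0 : t != 0 by apply: contraTneq t_lt0 => ->; rewrite ord_at0.
elim/poly_ind: p => [|p c IHp]; first by rewrite eqxx.
rewrite size_MXaddC rmorphD rmorphM /= evalX_X evalX_C.
have [-> |p0 _] := eqVneq p 0.
  rewrite rmorph0 !mul0r !add0r polyC_eq0 size_poly0 => c0.
  by rewrite (negPf c0) /= fmorph_eq0 ord_const0.
have [hp0 vp] := IHp p0; rewrite /=.
have hpt : h p * t != 0 by rewrite mulf_neq0.
have vpt : v (h p * t) = v t *+ size p.
  by rewrite ord_mul // vp -mulrSr prednK // size_poly_gt0.
rewrite -vpt; apply: ordD_lt => //; apply: ord_ge_le (ord_ge_const _ _).
rewrite vpt lezD1 (polySpred p0) mulrS.
by have := mulrn_wle0 (size p).-1 (ltW t_lt0); lia.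
Qed.

End OrdEvalX.

(** At a point where [s] is a uniformizer and [t - a] vanishes to order [d], the
    terms of [sum_(i < d) u_i(t) s^i] have distinct orders. *)
Section TotallyRamified.

Variables (K L : fieldType) (iota : {rmorphism K -> L}) (P : place iota).
Variables (t s : L) (d : nat) (a : K).

Local Notation v := (ord_at P).
Local Notation h := (evalX iota t).
Local Notation ev := (evalXY iota t s).

Hypothesis d_gt0 : (0 < d)%N.
Hypothesis vs : v s = 1.
Hypothesis vt : v (t - iota a) = d%:Z.

Lemma ord_ramified (u : {poly {poly K}}) : (size u <= d)%N -> u != 0 ->
  ev u != 0 /\ forall i, u`_i != 0 -> v (ev u) <= (d * mup a u`_i + i)%:Z.
Proof.
move=> u_d u0; have vt0 : 0 < v (t - iota a) by rewrite vt.
have s0 : s != 0 by apply: contra_eqN vs => /eqP->; rewrite ord_at0.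
pose F (i : 'I_(size u)) := h u`_i * s ^+ i.
have F0 i : (F i != 0) = (u`_i != 0).
  rewrite mulf_eq0 expf_eq0 (negPf s0) andbF orbF.
  have [->|ui] := eqVneq u`_i 0; first by rewrite rmorph0 eqxx.
  by case: (ord_evalX_root vt0 ui).
have vF i : F i != 0 -> v (F i) = (d * mup a u`_i + i)%:Z.
  move=> Fi; have ui : u`_i != 0 by rewrite -F0.
  have [hu vu] := ord_evalX_root vt0 ui.
  rewrite ord_mul ?expf_neq0 // vu vt ordX vs natz; lia.
case: (@ord_sum_distinct _ _ _ P _ F).
- have u_gt0 : (0 < size u)%N by rewrite size_poly_gt0.
  have u_pred : ((size u).-1 < size u)%N by rewrite prednK.
  by exists (Ordinal u_pred); rewrite F0 /= -lead_coefE lead_coef_eq0.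
- move=> i j Fi Fj; rewrite !vF // => -[E]; apply: val_inj => /=.
  have := congr1 (modn^~ d) E; rewrite !(mulnC d) !modnMDl !modn_small //.
    by apply: leq_trans u_d.
  by apply: leq_trans u_d.
move=> i0 Fi0 [sum0 vsum vmin]; rewrite evalXYE; split=> // i ui.
have iu : (i < size u)%N by rewrite ltnNge; apply: contraNN ui => /(nth_default 0) ->.
by rewrite vsum -[i]/(val (Ordinal iu)) -vF ?F0 //; apply: vmin; rewrite F0.
Qed.

End TotallyRamified.


(** * Counting independent functions by their orders *)

Definition count_lt (S : nat -> bool) (n : nat) : nat := (\sum_(i < n) S i)%N.

Lemma count_ltS S n : count_lt S n.+1 = (count_lt S n + S n)%N.
Proof. exact: big_ord_recr. Qed.

Lemma count_lt_predT n : count_lt predT n = n.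
Proof. by rewrite /count_lt sum_nat_const card_ord muln1. Qed.

Section LinearIndependence.

Variables (K L : fieldType) (iota : {rmorphism K -> L}).

Definition lin_indep n (f : 'I_n -> L) :=
  forall c : 'I_n -> K, \sum_i iota (c i) * f i = 0 -> forall i, c i = 0.

Variables (P : place iota) (W : L -> Prop).

Local Notation v := (ord_at P).

Lemma lin_indep_extend n (f : 'I_n -> L) z : lin_indep f -> z != 0 ->
  (forall i, ord_ge P (v z + 1) (f i)) ->
  lin_indep (fun i : 'I_n.+1 => if unlift ord0 i is Some j then f j else z).
Proof.
move=> f_free z0 vf c; rewrite big_ord_recl unlift_none.
under eq_bigr => i _ do rewrite liftK.
have [c0|c0] := eqVneq (c ord0) 0.
  rewrite c0 rmorph0 mul0r add0r => /f_free cl i.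
  by have [j ->|->//] := unliftP ord0 i; apply: cl.
have cz : iota (c ord0) * z != 0 by rewrite mulf_neq0 ?fmorph_eq0.
move=> sum0; have [] := @ordD_lt _ _ _ P (iota (c ord0) * z)
    (\sum_(i < n) iota (c (lift ord0 i)) * f i) cz; last by rewrite sum0 eqxx.
apply: ord_ge_sum => i _; rewrite ord_mul ?fmorph_eq0 // ord_const0.
by rewrite add0r -[v z + 1]add0r ord_geM ?ord_ge_const.
Qed.

(** Functions of distinct orders at [P] are independent: a family of functions
    of order at least [b] is enlarged by functions of order [b - 1 - j]. *)
Lemma lin_indep_build (S : nat -> bool) (b : int) n0 (f0 : 'I_n0 -> L) M :
    lin_indep f0 -> (forall i, W (f0 i)) -> (forall i, ord_ge P b (f0 i)) ->
    (forall j, (j < M)%N -> S j -> exists z, [/\ W z, z != 0 & v z = b - 1 - j%:Z]) ->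
  exists f : 'I_(count_lt S M + n0) -> L,
    [/\ lin_indep f, forall i, W (f i) & forall i, ord_ge P (b - M%:Z) (f i)].
Proof.
move=> f0_free f0W f0b; elim: M => [|M IHM] ex_z.
  by rewrite /count_lt big_ord0 subr0; exists f0.
have [j jM Sj|f [f_free fW fb]] := IHM; first by apply: ex_z => //; apply: ltnW.
have le_b : b - M.+1%:Z <= b - M%:Z by rewrite lerD2l lerN2 lez_nat.
rewrite count_ltS; have [SM|_] := boolP (S M); last first.
  rewrite addn0; exists f; split=> // i; exact: ord_ge_le le_b (fb i).
have [z [Wz z0 vz]] := ex_z M (leqnn _) SM.
rewrite addn1 addSn.
exists (fun i => if unlift ord0 i is Some j then f j else z); split.
- apply: lin_indep_extend => // i; apply: ord_ge_le (fb i).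
  by rewrite vz addrAC subrK.
- by move=> i; case: unliftP.
move=> i; case: unliftP => [j _|_]; first exact: ord_ge_le le_b (fb j).
by rewrite ord_ge_neq0 // vz -addn1 PoszD opprD addrA addrAC.
Qed.

Hypothesis P_rational : rational_point P.
Hypothesis W_sub : forall c z w, W z -> W w -> W (z - iota c * w).

(** Being regular at a rational point imposes one linear condition per order. *)
Lemma lin_indep_drop n (f : 'I_n.+1 -> L) (k : int) :
    lin_indep f -> (forall i, W (f i)) -> (forall i, ord_ge P k (f i)) ->
  exists g : 'I_n -> L,
    [/\ lin_indep g, forall i, W (g i) & forall i, ord_ge P (k + 1) (g i)].
Proof.
move=> f_free fW fk.
suff [i0 [c cE]] : exists i0 (c : 'I_n -> K), forall i,
    ord_ge P (k + 1) (f (lift i0 i) - iota (c i) * f i0).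
  exists (fun i => f (lift i0 i) - iota (c i) * f i0); split=> //; last first.
    by move=> i; apply: W_sub.
  move=> b sum0 i.
  (* A relation between the [g] gives one between the [f]. *)
  pose b' (j : 'I_n.+1) := if unlift i0 j is Some l then b l else - \sum_l b l * c l.
  have <- : b' (lift i0 i) = b i by rewrite /b' liftK.
  apply: f_free; rewrite (bigD1_ord i0) //= /b' unlift_none.
  under eq_bigr => l _ do rewrite liftK.
  rewrite -[RHS]sum0 rmorphN rmorph_sum mulNr mulr_suml addrC -sumrB.
  by apply: eq_bigr => l _; rewrite rmorphM mulrBr mulrA.
have [all_ge|not_ge] := EM (forall i, ord_ge P (k + 1) (f i)).
  by exists ord_max, (fun=> 0) => i; rewrite rmorph0 mul0r subr0.
have [i0 /negP fi0] : exists i0, ~ ord_ge P (k + 1) (f i0) by apply/existsNP.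
have [fi0_neq0 vfi0] : f i0 != 0 /\ v (f i0) = k.
  move: fi0 (fk i0); rewrite /ord_ge; case: eqP => //= _; rewrite -ltNge ltzD1.
  by move=> le1 le2; split=> //; apply/eqP; rewrite eq_le le1.
suff /boolp.choice[c cE] : forall i, exists c,
    ord_ge P (k + 1) (f (lift i0 i) - iota c * f i0) by exists i0, c.
move=> i; set z := f (lift i0 i).
have [z0|z0] := eqVneq z 0; first by exists 0; rewrite z0 rmorph0 mul0r subr0 ord_ge0.
have q0 : z / f i0 != 0 by rewrite mulf_neq0 ?invr_eq0.
have vq : 0 <= v (z / f i0).
  rewrite ord_mul ?invr_eq0 // ordV vfi0 subr_ge0.
  by have := fk (lift i0 i); rewrite ord_ge_neq0.
have [c cE] := P_rational q0 vq; exists c.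
have -> : z - iota c * f i0 = f i0 * (z / f i0 - iota c).
  by rewrite mulrBr mulrCA divff // mulr1 [f i0 * _]mulrC.
apply: ord_geM; first by rewrite ord_ge_neq0 // vfi0.
case: cE => [->|vqc]; first by rewrite subrr ord_ge0.
by rewrite /ord_ge -gtz0_ge1 vqc orbT.
Qed.

(** Imposing order at least [b] on functions of order at least [b - N] costs a
    dimension only for those orders [b - 1 - j] that occur in [W]. *)
Lemma lin_indep_descent (S : nat -> bool) (b : int) N n
    (f : 'I_(n + count_lt S N) -> L) :
    (forall z j, W z -> z != 0 -> v z = b - 1 - j%:Z -> S j) ->
    lin_indep f -> (forall i, W (f i)) -> (forall i, ord_ge P (b - N%:Z) (f i)) ->
  exists g : 'I_n -> L,
    [/\ lin_indep g, forall i, W (g i) & forall i, ord_ge P b (g i)].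
Proof.
move=> WS; elim: N f => [|N IHN].
  by rewrite /count_lt big_ord0 addn0 subr0 => f; exists f.
have bN : b - N.+1%:Z + 1 = b - N%:Z by rewrite -addn1 PoszD; ring.
rewrite count_ltS; have [SN|SN] := boolP (S N).
  rewrite addn1 addnS => f f_free fW fb.
  have [g [g_free gW gb]] := lin_indep_drop f_free fW fb.
  by rewrite bN in gb; apply: IHN gb.
rewrite addn0 => f f_free fW fb; apply: (IHN f) => // i; rewrite -bN.
have := fb i; rewrite /ord_ge; have [//|fi0 /=] := eqVneq (f i) 0.
rewrite lezD1 le_eqVlt => /orP[/eqP vfi|->//].
case/negP: SN; apply: (WS (f i)) => //.
by rewrite -vfi -addn1 PoszD; ring.
Qed.

End LinearIndependence.

(** * The semigroups *)

Section WeierstrassSemigroup.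

Variables (K L : fieldType) (iota : {rmorphism K -> L}) (P : place iota).

Lemma weierstrass_function n : weierstrass_semigroup P n ->
  exists z, [/\ z != 0, (0 < n)%N -> ord_at P z = - n%:Z
    & forall Q : place iota, ~ same_place Q P -> ord_ge Q 0 z].
Proof.
move=> [z [z0 zP zQ]]; exists z; split=> //.
  by move: zP; rewrite /pole_order; lia.
by move=> Q /zQ; rewrite /pole_order ord_ge_neq0 //; lia.
Qed.

Lemma weierstrass_semigroup0 : weierstrass_semigroup P 0.
Proof.
exists 1; split; first exact: oner_neq0.
  by rewrite /pole_order ord_one.
by move=> Q _; rewrite /pole_order ord_one.
Qed.

Lemma weierstrass_semigroupD m n : weierstrass_semigroup P m ->
  weierstrass_semigroup P n -> weierstrass_semigroup P (m + n).
Proof.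
have [->//|m_gt0] := posnP m; have [->|n_gt0] := posnP n; first by rewrite addn0.
move=> /weierstrass_function[z [z0 /(_ m_gt0) vz zreg]].
move=> /weierstrass_function[w [w0 /(_ n_gt0) vw wreg]].
exists (z * w); split; first by rewrite mulf_neq0.
  by rewrite /pole_order ord_mul // vz vw; lia.
move=> Q QP; have := zreg Q QP; have := wreg Q QP.
by rewrite /pole_order !ord_ge_neq0 // ord_mul //; lia.
Qed.

Lemma weierstrass_generated (s : seq nat) n :
    (forall m, m \in s -> weierstrass_semigroup P m) ->
  generated_semigroup s n -> weierstrass_semigroup P n.
Proof.
move=> sH [c ->].
elim/big_ind: _ => [||i _].
- exact: weierstrass_semigroup0.
- exact: weierstrass_semigroupD.
elim: (c i) => [|k IHk]; first exact: weierstrass_semigroup0.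
by rewrite mulSn; apply: weierstrass_semigroupD => //; apply/sH/mem_nth.
Qed.

End WeierstrassSemigroup.

Lemma generated_semigroup0 s : generated_semigroup s 0.
Proof. by exists (fun=> 0%N); rewrite big1. Qed.

Lemma generated_semigroupD s m n : generated_semigroup s m ->
  generated_semigroup s n -> generated_semigroup s (m + n).
Proof.
move=> [c ->] [c' ->]; exists (fun i => c i + c' i)%N.
by rewrite -big_split; apply: eq_bigr => i _; rewrite mulnDl.
Qed.

Lemma generated_semigroup_mem (s : seq nat) n : n \in s -> generated_semigroup s n.
Proof.
move=> ns; have ns' : (index n s < size s)%N by rewrite index_mem.
exists (fun i => i == Ordinal ns'); rewrite (bigD1 (Ordinal ns')) //= eqxx.
rewrite mul1n nth_index // big1 ?addn0 // => i /negPf ->.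
by rewrite mul0n.
Qed.

(** These are the pole orders at [t = oo] of the monomials [t^a y^b] without other
    poles, see [monomial_regular]. *)
Definition monomial_order (d n : nat) :=
  exists a b, (b.*2 <= d * a)%N /\ n = (d * a + b.*2)%N.

(** Write [n = q d + r]; as [d] is odd, one of [a = q] and [a = q - 1] makes
    [n - d a] even. *)
Lemma monomial_order_large d n : odd d -> (3 * d <= n)%N -> monomial_order d n.
Proof.
move=> d_odd n3d; have d_gt0 : (0 < d)%N by case: d d_odd {n3d}.
pose q := (n %/ d)%N; pose r := (n %% d)%N.
have nE : n = (q * d + r)%N := divn_eq n d.
have r_lt : (r < d)%N by rewrite ltn_mod.
have q3 : (3 <= q)%N by rewrite leq_divRL.
have [r_odd|r_even] := boolP (odd r).
  exists q.-1, (d + r)./2; have : odd (d + r) = false by rewrite oddD d_odd r_odd.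
  move=> /negbT/even_halfK ->; case: q nE q3 => // q' nE q3 /=; split; nia.
by exists q, r./2; rewrite even_halfK //; split; nia.
Qed.

(** Generators [d + 2 j] with [j] as large as possible, at most [(d - 1) / 2], are
    split off. This preserves [2 b <= d a] except in the case of equality, when
    the number is [d (2 a)]. *)
Lemma monomial_order_generated q0 d n : d.*2 = q0.+1 -> odd d ->
  monomial_order d n -> generated_semigroup (P3_generators q0 d) n.
Proof.
move=> dE d_odd; set s := P3_generators q0 d.
have gen_j j : (j <= d./2)%N -> generated_semigroup s (d + j.*2).
  move=> jd; apply: generated_semigroup_mem; rewrite mem_rcons inE.
  apply/orP; right; apply/mapP; exists j; last by lia.
  by rewrite mem_iota; lia.
have gen_d a : generated_semigroup s (d * a).
  elim: a => [|a IHa]; first by rewrite muln0; apply: generated_semigroup0.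
  rewrite mulnS; apply: generated_semigroupD => //.
  by have := gen_j 0%N; rewrite addn0; apply.
move=> [a [b [ba ->]]]; elim: a b ba => [|a IHa] b ba.
  have -> : b = 0%N by lia.
  by rewrite muln0; apply: generated_semigroup0.
have [b_d|d_b] := leqP b d./2.
  by rewrite mulnS addnAC; apply: generated_semigroupD; [apply: gen_j|apply: gen_d].
have [E|ne] := eqVneq b.*2 (d * a.+1)%N; first by rewrite E -mulnDr; apply: gen_d.
have d_half : d = d./2.*2.+1 by rewrite -[LHS]odd_double_half d_odd.
have -> : (d * a.+1 + b.*2 = (d + d./2.*2) + (d * a + (b - d./2).*2))%N.
  by rewrite mulnS doubleB; lia.
apply: generated_semigroupD; first exact: gen_j.
apply: IHa; rewrite mulnS in ba ne; move: (d * a)%N ba ne => da; lia.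
Qed.

(** * The curve as a Kummer extension *)

Section Curve.

Variables (K L : fieldType) (iota : {rmorphism K -> L}) (d e : nat) (C i0 : K).

Hypothesis dE : d = e.*2.+1.
Hypothesis e_gt0 : (0 < e)%N.
Hypothesis dK : d%:R != 0 :> K.
Hypothesis K2 : 2%:R != 0 :> K.
Hypothesis C0 : C != 0.
Hypothesis i0E : i0 ^+ 2 = -1.

Record coordinates (t y : L) : Prop := Coordinates {
  coord_trans : forall p, evalX iota t p = 0 -> p = 0;
  coord_gen : generate iota t y;
  coord_eq : y ^+ d * t ^+ 2 = iota C * (t ^+ 4 - 1)
}.

Lemma coord_neq0 t y : coordinates t y -> t != 0.
Proof.
case=> trans _ _; apply/eqP => t0; have := trans 'X.
by rewrite evalX_X => /(_ t0)/eqP; rewrite polyX_eq0.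
Qed.

Lemma coord4_neq0 t y : coordinates t y -> t ^+ 4 - 1 != 0.
Proof.
case=> trans _ _; apply/eqP => t4; have := trans ('X^4 - 1%:P).
rewrite rmorphB rmorphXn /= evalX_X evalX_C rmorph1 => /(_ t4)/eqP.
by rewrite -size_poly_eq0 size_XnsubC.
Qed.

(** This symmetry exchanges the points above 0 and infinity. *)
Lemma coordV t y : coordinates t y -> coordinates t^-1 (- y).
Proof.
move=> co; have t0 := coord_neq0 co; case: co => trans gen eq; split.
- move=> p pV; apply: contra_eq pV => p0; apply/eqP => pV.
  have : algebraicOver iota t^-1 by exists p => //; apply/rootP; rewrite -evalXE.
  move=> /algebraic_inv; rewrite invrK => -[q q0 /rootP].
  by rewrite -evalXE => /trans q0'; rewrite q0' eqxx in q0.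
- move=> F F_sf Ft Fy; apply: gen => //.
    by rewrite -[t]invrK; apply: (subfield_inv F_sf).
  rewrite -[y]opprK -[- - y]sub0r; apply: (subfield_sub F_sf) => //.
  exact: (subfield0 F_sf).
have y_eq : y ^+ d = iota C * (t ^+ 4 - 1) / t ^+ 2 by rewrite -eq mulfK ?expf_neq0.
rewrite exprNn -signr_odd dE /= odd_double -dE y_eq /= expr1.
by field.
Qed.

Section WithCoordinates.

Variables (t y : L).
Hypothesis co : coordinates t y.

Let trans := coord_trans co.
Let t0 := coord_neq0 co.
Let t4 := coord4_neq0 co.
Let d_gt0 : (0 < d)%N. Proof. by rewrite dE. Qed.

Local Notation h := (evalX iota t).

Lemma y_neq0 : y != 0.
Proof.
apply: contraTneq isT => y0; have := coord_eq co.
rewrite y0 expr0n gtn_eqF // mul0r => /eqP; rewrite eq_sym mulf_eq0.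
by rewrite fmorph_eq0 (negPf C0) (negPf t4).
Qed.

Lemma ord_y_coord (P : place iota) :
  d%:Z * ord_at P y + 2 * ord_at P t = ord_at P (t ^+ 4 - 1).
Proof.
have := congr1 (ord_at P) (coord_eq co).
rewrite !ord_mul ?expf_neq0 ?y_neq0 ?fmorph_eq0 // !ordX ord_const0 add0r => <-.
lia.
Qed.

Lemma ord_t4_zero (P : place iota) : 0 < ord_at P t -> ord_at P (t ^+ 4 - 1) = 0.
Proof.
move=> vt; have vt' : 0 < ord_at P (t - iota 0) by rewrite rmorph0 subr0.
have := @ord_evalX_nonroot _ _ _ P t 0 ('X^4 - 1%:P) vt'.
rewrite rmorphB rmorphXn /= evalX_X evalX_C rmorph1 /root !hornerE.
by rewrite expr0n /= sub0r oppr_eq0 oner_eq0 rmorph1 => /(_ isT)[].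
Qed.

(** Since [y] has a pole above 0, the integral generator [t y] is used to study
    functions over the affine line. *)
Definition affine_eqn : {poly K} := C *: ('X ^+ (d - 2) * ('X^4 - 1)).

Local Notation ev := (evalXY iota t (t * y)).

Let d_ge2 : (2 < d)%N. Proof. by rewrite dE; lia. Qed.

Lemma affine_eqnE : (t * y) ^+ d = h affine_eqn.
Proof.
rewrite /affine_eqn -mul_polyC !rmorphM rmorphB rmorph1 !rmorphXn /= evalX_C evalX_X.
rewrite mulrCA -(coord_eq co) exprMn mulrCA -exprD subnK ?(ltnW d_ge2) //.
by rewrite mulrC.
Qed.

Lemma affine_gen : generate iota t (t * y).
Proof.
move=> F F_sf Ft Fs; apply: (coord_gen co) => //.
rewrite -[y](mulKf t0); apply: (subfield_mul F_sf) => //.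
exact: (subfield_inv F_sf).
Qed.

Lemma place_at_root_of_unity (z : K) : z ^+ 4 = 1 -> exists P : place iota,
  ord_at P (t * y) = 1 /\ ord_at P (t - iota z) = d%:Z.
Proof.
move=> z4.
have z0 : z != 0.
  by apply: contra_eqN z4 => /eqP->; rewrite expr0n eq_sym oner_eq0.
pose g1 := C *: ('X ^+ (d - 2) * ('X^3 + z *: 'X^2 + (z ^+ 2) *: 'X + (z ^+ 3)%:P)).
have gE : affine_eqn = ('X - z%:P) * g1.
  rewrite /affine_eqn /g1 -scalerAr; congr (_ *: _).
  rewrite mulrCA; congr (_ * _); rewrite -!mul_polyC !rmorphXn /=.
  have z4' : z%:P ^+ 4 = 1 :> {poly K} by rewrite -rmorphXn z4.
  by rewrite -z4'; ring.
have g1z : g1.[z] != 0.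
  have -> : g1.[z] = C * (z ^+ (d - 2) * (2%:R ^+ 2 * z ^+ 3)).
    by rewrite /g1 !hornerE /=; ring.
  by rewrite !mulf_neq0 ?expf_neq0.
have [P [vs vt _]] := ramified_place d_gt0 affine_eqnE trans affine_gen gE g1z.
by exists P.
Qed.

(** The terms have distinct orders at the point [t = 1]. *)
Lemma affine_free (u : {poly {poly K}}) : (size u <= d)%N -> ev u = 0 -> u = 0.
Proof.
have [P [vs vt]] := place_at_root_of_unity (expr1n _ 4).
move=> u_d /eqP; apply: contraTeq => u0.
by case: (ord_ramified d_gt0 vs vt u_d u0).
Qed.

(** With [d = 2 e + 1], the function [s = t y^e] has order [d - 2 e = 1] at 0,
    and [s^d = t (C (t^4 - 1))^e] has a simple zero there. *)
Lemma place_at_zero : exists P : place iota,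
  [/\ rational_point P, ord_at P t = d%:Z & ord_at P y = -2].
Proof.
pose g1 : {poly K} := (C *: ('X^4 - 1)) ^+ e.
have E : (t * y ^+ e) ^+ d = h (('X - 0%:P) * g1).
  rewrite evalX_M evalX_XsubC rmorph0 subr0 /g1 -mul_polyC rmorphXn rmorphM /=.
  rewrite rmorphB rmorphXn rmorph1 /= evalX_C evalX_X -(coord_eq co).
  by rewrite exprMn exprAC [RHS]mulrC exprMn -(exprM t) mul2n -mulrA -exprSr -dE mulrC.
have g10 : g1.[0] != 0.
  rewrite /g1 horner_exp expf_neq0 // !hornerE expr0n /= sub0r.
  by rewrite mulrN1 oppr_eq0.
have gen : generate iota t (t * y ^+ e).
  move=> F F_sf Ft Fs; apply: (coord_gen co) => //.
  have -> : y = iota C * (t ^+ 4 - 1) / (t * y ^+ e) ^+ 2.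
    rewrite -(coord_eq co); apply: (canRL (mulfK _)).
      by rewrite expf_neq0 ?mulf_neq0 ?expf_neq0 ?y_neq0.
    by rewrite exprMn -exprM muln2 mulrCA -exprS -dE mulrC.
  have F1 : F 1 by rewrite -(rmorph1 iota); apply: (subfield_const F_sf).
  apply: (subfield_mul F_sf).
    apply: (subfield_mul F_sf); first exact: (subfield_const F_sf).
    by apply: (subfield_sub F_sf) => //; exact: (subfield_exp F_sf).
  by apply: (subfield_inv F_sf); exact: (subfield_exp F_sf).
have [P [_ vt ratP]] := ramified_place d_gt0 E trans gen erefl g10.
rewrite rmorph0 subr0 in vt; exists P; split=> //.
have := ord_y_coord P; rewrite ord_t4_zero vt ?ltz_nat //.
move=> yE; have : d%:Z * (ord_at P y + 2) == 0 by apply/eqP; rewrite -[RHS]yE; ring.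
by rewrite mulf_eq0 addr_eq0 eqz_nat gtn_eqF // => /eqP.
Qed.

Lemma irreducible_dvd_affine_eqn (pi : {poly K}) :
    irreducible_poly pi -> pi %| affine_eqn ->
  'X %| pi \/ exists2 z : K, z ^+ 4 = 1 & 'X - z%:P %| pi.
Proof.
move=> pi_irr; have pi1 : size pi != 1%N by rewrite gtn_eqF //; case: pi_irr.
have pi_mul u w := @irreducible_dvdM _ pi u w pi_irr.
have pi_lin z : pi %| 'X - z%:P -> 'X - z%:P %| pi.
  by case: (irredp_XsubC z) => _ lin /(lin _ pi1); rewrite /eqp => /andP[].
rewrite /affine_eqn dvdpZr // => /pi_mul/orP[piX|].
  left; rewrite -['X]subr0; apply: pi_lin; rewrite subr0.
  elim: (d - 2)%N piX => [|n IHn].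
    by rewrite expr0 dvdp1 (negPf pi1).
  by rewrite exprS => /pi_mul/orP[].
have -> : 'X^4 - 1 = (('X - 1%:P) * ('X - (-1)%:P)) * (('X - i0%:P) * ('X - (- i0)%:P)).
  have E : i0%:P ^+ 2 = -1 :> {poly K} by rewrite -rmorphXn i0E rmorphN.
  rewrite !polyCN polyC1.
  have -> : ('X - i0%:P) * ('X - - i0%:P) = 'X ^+ 2 - i0%:P ^+ 2 by ring.
  by rewrite E; ring.
have i04 : i0 ^+ 4 = 1 by rewrite (exprM i0 2 2) i0E; ring.
move=> piE; right; case/orP: (pi_mul _ _ piE) => /pi_mul/orP[] /pi_lin.
- by exists 1; rewrite ?expr1n.
- by exists (-1); first by ring.
- by exists i0.
- by exists (- i0); first by rewrite -[RHS]i04; ring.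
Qed.

(** All terms of the numerator have order at least [d] at the point [t = z], as
    their orders are distinct; for [i < d] this makes [u_i(t)] vanish there. *)
Lemma regular_ramified (z : K) (w : L) (a : {poly K}) (u : {poly {poly K}}) :
    z ^+ 4 = 1 -> a != 0 -> 'X - z%:P %| a -> (size u <= d)%N ->
    h a * w = ev u -> regular_finite iota t w ->
  exists u', u = ('X - z%:P)%:P * u'.
Proof.
move=> z4 a0 za u_d E w_reg; have [P [vs vt]] := place_at_root_of_unity z4.
apply: dvd_polyC_coef => i.
have [->|ui] := eqVneq u`_i 0; first exact: dvdp0.
have u0 : u != 0 by apply: contraNneq ui => ->; rewrite coef0.
have [evu /(_ i ui) le_i] := ord_ramified d_gt0 vs vt u_d u0.
have iu : (i < size u)%N by rewrite ltnNge; apply: contraNN ui => /(nth_default 0) ->.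
have vt0 : 0 < ord_at P (t - iota z) by rewrite vt ltz_nat.
have [ha va] := ord_evalX_root vt0 a0.
have w0 : w != 0 by apply: contraNneq evu => w0; rewrite -E w0 mulr0.
have tP : ord_ge P 0 t.
  by rewrite -(subrK (iota z) t) ord_geD ?ord_ge_const // /ord_ge ltW ?orbT.
have := w_reg P tP; rewrite ord_ge_neq0 // => vw.
move: le_i; rewrite -E ord_mul // va vt XsubC_dvd // => le_i.
have : (0 < mup z a)%N by rewrite -XsubC_dvd.
case: (mup z u`_i) le_i => [|//]; rewrite muln0 add0n => le_i mup_gt0.
have := leq_trans iu u_d; rewrite ltnNge => /negP[].
rewrite -lez_nat; apply: le_trans le_i; rewrite -[X in X <= _]addr0 lerD //.
by rewrite mulrnZ -PoszM lez_nat leq_pmulr.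
Qed.

(** Every prime other than [t] cancels from the denominator. *)
Lemma regular_denominator w : regular_finite iota t w ->
  exists k (u : {poly {poly K}}), (size u <= d)%N /\ t ^+ k * w = ev u.
Proof.
have strip n : forall w (a : {poly K}) (u : {poly {poly K}}), (size a <= n)%N ->
    a != 0 -> (size u <= d)%N -> h a * w = ev u -> regular_finite iota t w ->
  exists k (u : {poly {poly K}}), (size u <= d)%N /\ t ^+ k * w = ev u.
  elim: n => [|n IHn] {}w a u; first by rewrite leqn0 size_poly_eq0 => ->.
  move=> an a0 u_d E w_reg.
  have [a1|a1] := leqP (size a) 1.
    have [c aE] : exists c, a = c%:P by exists a`_0; apply: size1_polyC.
    have c0 : c != 0 by rewrite aE polyC_eq0 in a0.
    exists 0%N, ((c^-1)%:P%:P * u); split.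
      by rewrite size_Cmul // polyC_eq0 invr_eq0.
    rewrite mul1r evalXYM evalXY_C evalX_C -E aE evalX_C fmorphV mulKf //.
    by rewrite fmorph_eq0.
  have divide p u' : p %| a -> (1 < size p)%N -> u = p%:P * u' ->
      exists k (u : {poly {poly K}}), (size u <= d)%N /\ t ^+ k * w = ev u.
    move=> /dvdpP[q aE] p1 uE.
    have p0 : p != 0 by rewrite -size_poly_gt0 ltnW.
    have q0 : q != 0 by apply: contraNneq a0 => q0; rewrite aE q0 mul0r.
    have hp0 : h p != 0 by apply: contra_neq p0; apply: trans.
    apply: (IHn w q u') => //.
    - rewrite -ltnS; apply: leq_trans an; rewrite aE size_mul //.
      by rewrite -subn1 ltn_subRL addnC ltn_add2l.
    - by apply: leq_trans u_d; rewrite uE size_Cmul.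
    apply: (mulfI hp0); rewrite mulrA -evalX_M [p * q]mulrC -aE E uE.
    by rewrite evalXYM evalXY_C.
  have [pi pi_irr pi_a] := irreducible_factor a1.
  have [pi_g|pi_g] := boolP (pi %| affine_eqn); last first.
    have [u' uE] := regular_unramified d_gt0 dK affine_eqnE trans affine_gen
      affine_free pi_irr pi_g a0 pi_a u_d E w_reg.
    by apply: (divide pi u') => //; case: pi_irr.
  have [Xpi|[z z4 zpi]] := irreducible_dvd_affine_eqn pi_irr pi_g.
    have /dvdpP[q aE] := dvdp_trans Xpi pi_a.
    have q0 : q != 0 by apply: contraNneq a0 => q0; rewrite aE q0 mul0r.
    have [|||k [u' [u'_d u'E]]] := IHn (t * w) q u _ q0 u_d.
    - by rewrite -ltnS; apply: leq_trans an; rewrite aE size_mulX.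
    - by rewrite -E aE evalX_M evalX_X mulrA.
    - by move=> P tP; rewrite -(addr0 0) ord_geM // w_reg.
    by exists k.+1, u'; rewrite exprSr -mulrA.
  have za := dvdp_trans zpi pi_a.
  have [u' uE] := regular_ramified z4 a0 za u_d E w_reg.
  by apply: (divide ('X - z%:P) u') => //; rewrite size_XsubC.
move=> w_reg; have [u [b [b0 wE]]] := generate_frac affine_gen w.
have [b' [a [a0 aE]]] := ev_dvd_evalX d_gt0 affine_eqnE b0.
have [_ [u' [u'_d _ u'E]]] := ev_reduce d_gt0 affine_eqnE (u * b').
apply: (strip _ w a u' (leqnn _) a0 u'_d _ w_reg).
rewrite u'E evalXYM wE -aE [ev b * _]mulrC -mulrA [ev b * _]mulrC divfK //.
by rewrite mulrC.
Qed.

(** As [d] is odd, twice the exponent of [y] is determined by the order modulo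
    [d]. *)
Let distinct_mod (a b : int) (i j : nat) : (i < d)%N -> (j < d)%N ->
  d%:Z * a + 2 * i%:Z = d%:Z * b + 2 * j%:Z -> i = j.
Proof.
move=> i_d j_d E; have dZ : d%:Z = 2 * e%:Z + 1 by rewrite dE -addn1 -mul2n PoszD PoszM.
have : [\/ a = b, a = b + 1 | b = a + 1].
  have [lt_ab|lt_ba|->] := ltgtP a b; [apply: Or33|apply: Or32|exact: Or31]; nia.
by case=> ab; rewrite ab in E; lia.
Qed.

Lemma ord_y_pole (Q : place iota) :
  ord_at Q t < 0 -> d%:Z * ord_at Q y = 2 * ord_at Q t.
Proof.
move=> vt; have := ord_y_coord Q; have -> : t ^+ 4 - 1 = h ('X^4 - 1%:P).
  by rewrite rmorphB rmorphXn /= evalX_X evalX_C rmorph1.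
have p0 : 'X^4 - 1%:P != 0 :> {poly K} by rewrite -size_poly_eq0 size_XnsubC.
have [_ ->] := ord_evalX_pole vt p0.
by rewrite size_XnsubC //= mulrnZ; lia.
Qed.

Lemma ord_pole (Q : place iota) (u : {poly {poly K}}) :
    ord_at Q t < 0 -> (size u <= d)%N -> u != 0 ->
  exists i : nat, u`_i != 0 /\ d%:Z * ord_at Q (ev u) =
    ord_at Q t * (d * ((size u`_i).-1 + i) + i.*2)%:Z.
Proof.
move=> vt u_d u0; have vy := ord_y_pole vt.
have s0 : t * y != 0 by rewrite mulf_neq0 // y_neq0.
pose F (i : 'I_(size u)) := h u`_i * (t * y) ^+ i.
have F0 i : (F i != 0) = (u`_i != 0).
  rewrite mulf_eq0 expf_eq0 (negPf s0) andbF orbF.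
  have [->|ui] := eqVneq u`_i 0; first by rewrite rmorph0 eqxx.
  by case: (ord_evalX_pole vt ui).
have vF i : F i != 0 -> d%:Z * ord_at Q (F i) =
    ord_at Q t * (d * ((size u`_i).-1 + i) + i.*2)%:Z.
  move=> Fi; have ui : u`_i != 0 by rewrite -F0.
  have [hu vu] := ord_evalX_pole vt ui.
  rewrite ord_mul ?expf_neq0 // vu ordX ord_mul ?y_neq0 //.
  rewrite !mulrnZ PoszD PoszM PoszD -mul2n PoszM mulrDr mulrDl mulrDr.
  rewrite [d%:Z * (ord_at Q y * _)]mulrA vy; ring.
case: (@ord_sum_distinct _ _ _ Q _ F).
- have u_gt0 : (0 < size u)%N by rewrite size_poly_gt0.
  have u_pred : ((size u).-1 < size u)%N by rewrite prednK.
  by exists (Ordinal u_pred); rewrite F0 /= -lead_coefE lead_coef_eq0.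
- move=> i j Fi Fj E; apply: val_inj => /=.
  have := congr1 (fun n => d%:Z * n) E; rewrite !vF // => /mulfI.
  rewrite lt_eqF // => /(_ isT) E'.
  apply: (@distinct_mod ((size u`_i).-1 + i)%:Z ((size u`_j).-1 + j)%:Z).
  + exact: leq_trans u_d.
  + exact: leq_trans u_d.
  by move: E'; rewrite -!mul2n !PoszD !PoszM.
by move=> i1 Fi1 [_ vsum _]; exists i1; rewrite evalXYE vsum vF // -F0.
Qed.

(** The terms have distinct orders at 0 too, so none of them has a pole there. *)
Lemma regular_at_zero (w : L) k (u : {poly {poly K}}) i :
    regular_finite iota t w -> (size u <= d)%N -> t ^+ k * w = ev u ->
    u`_i != 0 -> (d * k + i.*2 <= d * ((size (u`_i)%R).-1 + i))%N.
Proof.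
move=> w_reg u_d E ui; have [P [_ vt vy]] := place_at_zero.
have vt' : 0 < ord_at P (t - iota 0) by rewrite rmorph0 subr0 vt ltz_nat.
have s0 : t * y != 0 by rewrite mulf_neq0 // y_neq0.
pose F (i : 'I_(size u)) := h u`_i * (t * y) ^+ i.
have F0 j : (F j != 0) = (u`_j != 0).
  rewrite mulf_eq0 expf_eq0 (negPf s0) andbF orbF.
  have [->|uj] := eqVneq u`_j 0; first by rewrite rmorph0 eqxx.
  by case: (ord_evalX_root vt' uj).
have vF j : F j != 0 ->
    ord_at P (F j) = d%:Z * (mup 0 u`_j + j)%:Z - 2 * j%:Z.
  move=> Fj; have uj : u`_j != 0 by rewrite -F0.
  have [hu vu] := ord_evalX_root vt' uj.
  rewrite ord_mul ?expf_neq0 // vu rmorph0 subr0 vt ordX ord_mul ?y_neq0 //.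
  by rewrite vt vy !mulrnZ PoszD; ring.
have iu : (i < size u)%N by rewrite ltnNge; apply: contraNN ui => /(nth_default 0) ->.
case: (@ord_sum_distinct _ _ _ P _ F).
- by exists (Ordinal iu); rewrite F0.
- move=> j l Fj Fl; rewrite !vF // => E'; apply: val_inj => /=.
  apply: (@distinct_mod (mup 0 u`_l + l)%:Z (mup 0 u`_j + j)%:Z).
  + exact: leq_trans u_d.
  + exact: leq_trans u_d.
  move: E'; move: (d%:Z * (mup 0%R u`_l + l)%:Z) (d%:Z * (mup 0%R u`_j + j)%:Z).
  by move=> A B /eqP; rewrite subr_eq => /eqP ->; ring.
move=> i1 Fi1; rewrite -evalXYE => -[evu vsum /(_ (Ordinal iu))].
rewrite F0 -vsum -E vF ?F0 //= => /(_ ui).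
have w0 : w != 0 by apply: contraNneq evu => w0; rewrite -E w0 mulr0.
have := w_reg P; rewrite !ord_ge_neq0 // vt => /(_ isT) vw.
rewrite ord_mul ?expf_neq0 // ordX vt => le.
have mup_size : (mup 0%R (u`_i)%R <= (size (u`_i)%R).-1)%N.
  have := mup_geq 0 (mup 0 u`_i) ui; rewrite leqnn => /esym/(dvdp_leq ui).
  by rewrite size_exp_XsubC; case: (size _).
have : (d * (mup 0%R (u`_i)%R + i) <= d * ((size (u`_i)%R).-1 + i))%N.
  by rewrite leq_mul2l leq_add2r mup_size orbT.
apply: leq_trans; rewrite -lez_nat -mul2n PoszD !PoszM.
move: le; rewrite mulrnZ lerBrDr; apply: le_trans.
by rewrite lerD2r lerDl.
Qed.

(** A function without finite poles is a combination of monomials [t^a y^b]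
    having no pole at [t = 0], that is with [2 b <= d a]; at a pole of [t] one
    of these monomials dominates. *)
Lemma regular_pole (w : L) (Q : place iota) :
    w != 0 -> regular_finite iota t w -> ord_at Q t < 0 ->
  exists a b : nat, (b.*2 <= d * a)%N /\
    d%:Z * ord_at Q w = ord_at Q t * (d * a + b.*2)%:Z.
Proof.
move=> w0 w_reg vt; have [k [u [u_d E]]] := regular_denominator w_reg.
have u0 : u != 0.
  apply: contra_neq w0 => u0; apply: (mulfI (expf_neq0 k t0)).
  by rewrite E u0 rmorph0 mulr0.
have [i [ui vu]] := ord_pole vt u_d u0.
have le := regular_at_zero w_reg u_d E ui.
have k_le : (k <= (size (u`_i)%R).-1 + i)%N.
  by rewrite -(leq_pmul2l d_gt0); apply: leq_trans le; apply: leq_addr.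
exists ((size (u`_i)%R).-1 + i - k)%N, i; split.
  by rewrite mulnBr leq_subRL // leq_mul2l k_le orbT.
move: vu; rewrite -E ord_mul ?expf_neq0 // ordX mulrnZ mulrDr => vu.
have -> : d%:Z * ord_at Q w =
  ord_at Q t * (d * ((size u`_i).-1 + i) + i.*2)%:Z - d%:Z * (ord_at Q t * k%:Z).
  by rewrite -vu addrC addKr.
by rewrite mulnBr !PoszD -subzn ?leq_pmul2l // !PoszM; ring.
Qed.

(** At a pole of [t] all orders are multiples of [- v(t) / d], which is an integer
    because [d] is odd and [d v(y) = 2 v(t)]; as valuations are normalized, this
    integer is 1. *)
Lemma ord_pole_normalized (Q : place iota) : ord_at Q t < 0 -> ord_at Q t = - d%:Z.
Proof.
move=> vt; have [z z0 vz] := ord_normalized Q.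
have [u [b [b0 zE]]] := generate_frac affine_gen z.
have [_ [u' [u'_d _ u'E]]] := ev_reduce d_gt0 affine_eqnE u.
have [_ [b' [b'_d _ b'E]]] := ev_reduce d_gt0 affine_eqnE b.
have b'0 : b' != 0 by apply: contraNneq b0 => b'0; rewrite -b'E b'0 rmorph0.
have u'0 : u' != 0.
  by apply: contraNneq z0 => u'0; rewrite zE -u'E u'0 rmorph0 mul0r.
have [i [_ vu]] := ord_pole vt u'_d u'0; have [j [_ vb]] := ord_pole vt b'_d b'0.
have ev_u0 : ev u != 0 by apply: contraNneq z0 => u0; rewrite zE u0 mul0r.
have := congr1 (fun n => d%:Z * n) vz; rewrite zE ord_mul ?invr_eq0 // ordV.
rewrite mulrBr -u'E -b'E vu vb -mulrBr mulr1 => dE'.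
have vy := ord_y_pole vt.
set m := (X in _ * X = _) in dE'.
have dZ : d%:Z = 2 * e%:Z + 1 by rewrite dE -addn1 -mul2n PoszD PoszM.
have [k kE] : exists k, ord_at Q t = d%:Z * k.
  by exists (ord_at Q t - e%:Z * ord_at Q y); rewrite mulrBr mulrCA vy dZ; ring.
have km : k * m = 1.
  apply: (@mulfI _ d%:Z); first by rewrite eqz_nat gtn_eqF.
  by rewrite mulr1 mulrA -kE.
have k_lt0 : k < 0 by move: vt; rewrite kE pmulr_rlt0.
have /eqP := congr1 absz km; rewrite abszM muln_eq1 => /andP[/eqP k1 _].
by rewrite kE -[k]opprK -(ltz0_abs k_lt0) k1 mulrN1.
Qed.

Lemma monomial_regular a b :
  (b.*2 <= d * a)%N -> regular_finite iota t (t ^+ a * y ^+ b).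
Proof.
move=> ba P; rewrite !ord_ge_neq0 ?mulf_neq0 ?expf_neq0 ?y_neq0 // => vt.
rewrite ord_mul ?expf_neq0 ?y_neq0 // !ordX !mulrnZ.
have : 0 <= ord_at P (t ^+ 4 - 1).
  have -> : t ^+ 4 - 1 = evalX iota t ('X^4 - 1%:P).
    by rewrite rmorphB rmorphXn /= evalX_X evalX_C rmorph1.
  have := @ord_ge_evalX _ _ _ P t ('X^4 - 1%:P); rewrite ord_ge_neq0 //.
  rewrite rmorphB rmorphXn /= evalX_X evalX_C rmorph1 ord_ge_neq0 ?(coord4_neq0 co) //.
  exact.
rewrite -ord_y_coord => vy.
rewrite -(pmulr_rge0 _ (_ : 0 < d%:Z)) ?ltz_nat //.
have -> : d%:Z * (ord_at P t * a%:Z + ord_at P y * b%:Z) =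
   b%:Z * (d%:Z * ord_at P y + 2 * ord_at P t) +
   ord_at P t * ((d * a)%:Z - (b.*2)%:Z) by rewrite -mul2n !PoszM; ring.
by rewrite addr_ge0 // mulr_ge0 // subr_ge0 lez_nat.
Qed.

Lemma weierstrass_pole (P : place iota) n :
  ord_at P t < 0 -> weierstrass_semigroup P n -> monomial_order d n.
Proof.
move=> vt /weierstrass_function[z [z0 vz z_reg]].
have [->|n_gt0] := posnP n; first by exists 0%N, 0%N; rewrite muln0.
have [|a [b [ab E]]] := regular_pole z0 _ vt.
  move=> Q tQ; apply: z_reg => /(_ t) QP; move: tQ.
  by rewrite ord_ge_neq0 // QP leNgt vt.
exists a, b; split=> //; move: E; rewrite vz // (ord_pole_normalized vt).
rewrite mulrN mulNr => /oppr_inj /mulfI; rewrite eqz_nat gtn_eqF // => /(_ isT).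
by case.
Qed.

End WithCoordinates.

Lemma place_at_infinity t y : coordinates t y -> exists Q : place iota,
  [/\ rational_point Q, ord_at Q t = - d%:Z & ord_at Q y = -2].
Proof.
move=> co; have [Q [Q_rat vt vy]] := place_at_zero (coordV co).
by exists Q; split=> //; [rewrite -vt ordV opprK|rewrite -vy ordN].
Qed.

(** * Comparison of a finite point with the point at infinity *)

Section FinitePoint.

Variables (t y : L).
Hypothesis co : coordinates t y.

Let t0 := coord_neq0 co.
Let y0 := y_neq0 co.
Let d_gt0 : (0 < d)%N. Proof. by rewrite dE. Qed.

Variable P : place iota.
Hypothesis P_rational : rational_point P.
Hypothesis P_finite : 0 <= ord_at P t.
Hypothesis P_orders : forall n, monomial_order d n -> weierstrass_semigroup P n.

Variable Q : place iota.
Hypothesis Q_rational : rational_point Q.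
Hypothesis Qt : ord_at Q t = - d%:Z.
Hypothesis Qy : ord_at Q y = -2.

Let QP : ~ same_place Q P.
Proof. by move=> /(_ t) E; move: P_finite; rewrite -E Qt; move: d_gt0; lia. Qed.

Let W z := forall R : place iota, ord_ge R 0 t -> ~ same_place R P -> ord_ge R 0 z.

Let W_sub c z w : W z -> W w -> W (z - iota c * w).
Proof.
move=> Wz Ww R Rt RP; rewrite ord_geD ?Wz // ord_geN -(addr0 0).
by rewrite ord_geM ?ord_ge_const // Ww.
Qed.

Let W_regular z : W z -> ord_ge P 0 z -> regular_finite iota t z.
Proof.
move=> Wz Pz R Rt; have [RP|/Wz] := EM (same_place R P); last exact.
by move: Pz; rewrite /ord_ge RP.
Qed.

Let W_mul z w : W z -> W w -> W (z * w).
Proof. by move=> Wz Ww R Rt RP; rewrite -(addr0 0) ord_geM ?Wz ?Ww. Qed.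

(** Take a function with a pole of order [d] at [P] only, subtract its value at
    [Q], and call [Z] the result, of order [f > 0] at [Q]. Every large [n] is the
    pole order at [Q] of a monomial; taking [n = j + 1 + 3 d f] and multiplying
    the monomial by [Z^(3 d)] gives the order [-1 - j]. *)
Lemma all_orders_at_infinity j : exists z, [/\ W z, z != 0 & ord_at Q z = -1 - j%:Z].
Proof.
have d_order : monomial_order d d by exists 1%N, 0%N; rewrite muln1 addn0.
have [z [z0 /(_ d_gt0) vz z_reg]] := weierstrass_function (P_orders d_order).
have vQz : 0 <= ord_at Q z by have := z_reg Q QP; rewrite ord_ge_neq0.
have [c [zc|vc]] := Q_rational z0 vQz.
  by move: vz; rewrite zc ord_const0; move: d_gt0; lia.
pose Z := z - iota c.
have Z0 : Z != 0 by apply: contraTneq vc => Zc; rewrite -/Z Zc ord_at0.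
have WZ : W Z.
  move=> R _ RP; rewrite ord_geD ?z_reg // ord_geN; exact: ord_ge_const.
have [f fE] : exists f : nat, ord_at Q Z = f%:Z.
  by exists `|ord_at Q Z|%N; rewrite gtz0_abs.
have f_gt0 : (0 < f)%N by rewrite -ltz_nat -fE.
have d_odd : odd d by rewrite dE /= odd_double.
have [||a [b [ab E]]] := @monomial_order_large d (j + 1 + 3 * d * f) => //.
  by apply: leq_trans (leq_addl _ _); apply: leq_pmulr.
exists (t ^+ a * y ^+ b * Z ^+ (3 * d)); split.
- apply: W_mul; first by move=> R Rt _; exact: (monomial_regular co).
  elim: (3 * d)%N => [|k IHk].
    by move=> R _ _; rewrite expr0 /ord_ge ord_one lexx orbT.
  by rewrite exprS; apply: W_mul.
- by rewrite !mulf_neq0 ?expf_neq0 .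
rewrite !ord_mul ?mulf_neq0 ?expf_neq0  // !ordX Qt Qy fE !mulrnZ.
move/(congr1 Posz): E; rewrite !PoszD !PoszM -mul2n PoszM => E.
have -> : -1 - j%:Z = - (j%:Z + 1) by rewrite opprD addrC.
have -> : j%:Z + 1 = d%:Z * a%:Z + 2 * b%:Z - 3 * d%:Z * f%:Z by rewrite -E; ring.
by ring.
Qed.

Lemma weierstrass_finite n : weierstrass_semigroup P n -> monomial_order d n.
Proof.
move=> nH; apply: contrapT => nS.
pose S k := `[< monomial_order d k >].
pose T k := S k || (k == n).
pose N := (3 * d)%N.
have d_odd : odd d by rewrite dE /= odd_double.
have S_large k : (N <= k)%N -> S k.
  by move=> Nk; apply/asboolP; apply: monomial_order_large.
have S0 : S 0%N by apply/asboolP; exists 0%N, 0%N; rewrite muln0.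
have n_gt0 : (0 < n)%N.
  by rewrite lt0n; apply/eqP => n0; apply: nS; rewrite n0; apply/asboolP.
have nN : (n < N)%N by rewrite ltnNge; apply/negP => /S_large/asboolP.
have [m Nm m_bound] : exists2 m, (N <= m)%N & forall j, (j < N)%N ->
    exists z, [/\ W z /\ ord_ge P (- m%:Z) z, z != 0 & ord_at Q z = -1 - j%:Z].
  elim: {2}N => [|M [m Nm IH]]; first by exists N => // j; rewrite ltn0.
  have [z [Wz z0 vz]] := all_orders_at_infinity M.
  exists (m + `|ord_at P z|)%N; first exact: leq_trans (leq_addr _ _).
  move=> j; rewrite ltnS leq_eqVlt => /orP[/eqP->|/IH[w [[Ww wP] w0 vw]]].
    exists z; split=> //; split=> //; rewrite ord_ge_neq0 //; lia.
  exists w; split=> //; split=> //; apply: ord_ge_le wP; lia.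
(* Among the pole orders allowed by [S] below [m + 1] those above [N] are all
   present, and [n] is one more. *)
have cntT : (N + count_lt T m.+1 = 1 + count_lt S N.+1 + m)%N.
  have cS M : (count_lt S (N + M).+1 = count_lt S N.+1 + M)%N.
    elim: M => [|M IHM]; first by rewrite !addn0.
    by rewrite addnS count_ltS IHM (S_large _ (leqW (leq_addr _ _))) addn1 addnS.
  have cT M : count_lt T M = (count_lt S M + (n < M))%N.
    elim: M => [|M IHM]; first by rewrite /count_lt !big_ord0.
    rewrite !count_ltS IHM /T; have [->|nM] := eqVneq M n.
      by rewrite orbT ltnn ltnSn; have /negbTE -> : ~~ S n by apply/asboolPn.
    by rewrite orbF ltnS [(n <= M)%N]leq_eqVlt eq_sym (negPf nM) /=; lia.
  rewrite cT -(subnKC Nm) cS; have -> : (n < (N + (m - N)).+1)%N by lia.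
  lia.
(* [f1] consists of functions whose only pole is [P]; [f2] adds the orders
   [-1, ..., -N] at [Q]; [f3] removes the poles at [P], and [f4] those at [Q],
   together with the constants. *)
pose W1 z := W z /\ ord_ge Q 0 z.
have [f1 [f1_free f1W f1P]] : exists f : 'I_(count_lt T m.+1 + 0) -> L,
    [/\ lin_indep iota f, forall i, W1 (f i) & forall i, ord_ge P (1 - m.+1%:Z) (f i)].
  apply: (@lin_indep_build _ _ _ P W1 T 1 0 (fun=> 0)); try by case.
    by move=> c _ [].
  move=> j jm Tj; have jH : weierstrass_semigroup P j.
    by case/orP: Tj => [/asboolP/P_orders|/eqP->].
  have [->|j_gt0] := posnP j.
    exists 1; split; [|exact: oner_neq0|by rewrite ord_one].
    by split=> [R _ _|]; rewrite /ord_ge ord_one lexx orbT.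
  have [z [z0 /(_ j_gt0) vz z_reg]] := weierstrass_function jH.
  exists z; split=> //; last by rewrite vz; lia.
  by split=> [R _ RP|]; apply: z_reg.
have E1 : 1 - m.+1%:Z = - m%:Z by lia.
rewrite E1 addn0 in f1 f1_free f1W f1P.
pose W2 z := W z /\ ord_ge P (- m%:Z) z.
have [f2 [f2_free f2W f2Q]] : exists f : 'I_(count_lt predT N + count_lt T m.+1) -> L,
    [/\ lin_indep iota f, forall i, W2 (f i) & forall i, ord_ge Q (0 - N%:Z) (f i)].
  apply: (@lin_indep_build _ _ _ Q W2 predT 0 _ f1) => //.
  - by move=> i; split=> //; case: (f1W i).
  - by move=> i; case: (f1W i).
  by move=> j jN _; have [z zP] := m_bound j jN; exists z; rewrite sub0r.
rewrite count_lt_predT cntT sub0r in f2 f2_free f2W f2Q.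
pose W3 z := W z /\ ord_ge Q (- N%:Z) z.
have W3_sub c z w : W3 z -> W3 w -> W3 (z - iota c * w).
  move=> [Wz Qz] [Ww Qw]; split; first exact: W_sub.
  by rewrite ord_geD // ord_geN -[- _]add0r ord_geM ?ord_ge_const.
have [f3 [f3_free f3W f3P]] : exists f : 'I_(1 + count_lt S N.+1) -> L,
    [/\ lin_indep iota f, forall i, W3 (f i) & forall i, ord_ge P 0 (f i)].
  rewrite -(count_lt_predT m) in f2 f2_free f2W f2Q.
  apply: (lin_indep_descent P_rational W3_sub _ f2_free) => //.
  - by move=> i; split=> //; case: (f2W i).
  - by move=> i; rewrite sub0r; case: (f2W i).
pose W4 z := W z /\ ord_ge P 0 z.
have W4_sub c z w : W4 z -> W4 w -> W4 (z - iota c * w).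
  move=> [Wz Pz] [Ww Pw]; split; first exact: W_sub.
  by rewrite ord_geD // ord_geN -[0]add0r ord_geM ?ord_ge_const.
have W4_order z : W4 z -> z != 0 -> exists2 k, monomial_order d k & ord_at Q z = - k%:Z.
  move=> [Wz Pz] z0; have Qt0 : ord_at Q t < 0 by rewrite Qt oppr_lt0 ltz_nat.
  have [a [b [ab E]]] := regular_pole co z0 (W_regular Wz Pz) Qt0.
  exists (d * a + b.*2)%N; first by exists a, b.
  apply: (@mulfI _ d%:Z); first by rewrite eqz_nat gtn_eqF.
  by rewrite E Qt mulNr mulrN.
have [|||f4 [f4_free f4W f4Q]] :=
    lin_indep_descent Q_rational W4_sub (S := S) (b := 1) (N := N.+1) _ f3_free.
- move=> z j /W4_order/[apply] -[k kS ->] E; have -> : j = k by lia.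
  exact/asboolP.
- by move=> i; split=> //; case: (f3W i).
- move=> i; have -> : 1 - N.+1%:Z = - N%:Z by lia.
  by case: (f3W i).
have f4_neq0 : f4 ord0 != 0.
  apply/eqP => f40; have := f4_free (fun=> 1); rewrite big_ord1 f40 mulr0.
  by move=> /(_ erefl ord0)/eqP; rewrite oner_eq0.
have [k _ vk] := W4_order _ (f4W ord0) f4_neq0.
by have := f4Q ord0; rewrite ord_ge_neq0 // vk; lia.
Qed.

End FinitePoint.


End Curve.

(** * Coordinates on the curve of the theorem *)

Lemma finField_sqrt_opp1 (K : finFieldType) :
  (4 %| #|K|.-1)%N -> exists i : K, i ^+ 2 = -1.
Proof.
move=> /dvdnP[m mE].
have K_gt1 : (1 < #|K|)%N := finNzRing_gt1 K.
have m_gt0 : (0 < m)%N by case: m mE => // mE; move: K_gt1 mE; lia.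
pose rs := [seq x <- enum K | x != 0].
have rs_size : size rs = (m * 4)%N.
  rewrite -mE size_filter -(cardC1 (0 : K)) cardE /enum_mem size_filter.
  by rewrite count_filter; apply: eq_count => x /=; rewrite !inE andbT.
have p_size : size ('X^(m * 2) - 1%:P : {poly K}) = (m * 2).+1.
  by rewrite size_XnsubC // muln_gt0 m_gt0.
have [x x0 xm] : exists2 x : K, x != 0 & x ^+ (m * 2) != 1.
  apply: contrapT => no_x; have := @max_poly_roots _ ('X^(m * 2) - 1%:P : {poly K}) rs.
  rewrite -size_poly_eq0 p_size => /(_ isT).
  rewrite filter_uniq ?enum_uniq // rs_size ltnS leq_mul2l orbF.
  suff -> : all (root ('X^(m * 2) - 1%:P)) rs.
    by move=> /(_ isT isT); rewrite gtn_eqF.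
  apply/allP => x; rewrite mem_filter => /andP[x0 _].
  rewrite /root !hornerE subr_eq0; apply: contraT => xm.
  by case: no_x; exists x.
exists (x ^+ m); rewrite -exprM; apply/eqP.
have : x ^+ (m * 4) == 1.
  rewrite -mE -(inj_eq (mulfI x0)) -exprS prednK ?(ltnW K_gt1) //.
  by rewrite mulr1 expf_card.
by rewrite (mulnA m 2 2) exprM sqrf_eq1 (negPf xm).
Qed.

Section Coordinates.

Variables (K L : fieldType) (iota : {rmorphism K -> L}) (q0 d : nat) (x y : L) (i0 : K).

Hypothesis dE : d.*2 = q0.+1.
Hypothesis L_X1 : is_function_field iota (X1_poly K q0) x y.
Hypothesis K2 : 2%:R != 0 :> K.
Hypothesis i0E : i0 ^+ 2 = -1.

Let f := X1_poly K q0.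

Lemma X1_relation : (y ^+ d) ^+ 2 = - (x ^+ 2 * (x ^+ 2 + 1)).
Proof.
have /(relations_generated L_X1) : exists h, f = h * f by exists 1; rewrite mul1r.
rewrite eval_inE /f /X1_poly !evalXYD !evalXYX evalXY_X evalXY_C evalX_X.
rewrite -dE -muln2 exprM.
by move/eqP; rewrite addrC addr_eq0 => /eqP ->; ring.
Qed.

(** The equation has positive degree in [Y], so no polynomial in [X] alone is a
    multiple of it. *)
Lemma X1_x_transcendental : ~ algebraicOver iota x.
Proof.
move=> [p p0 /rootP px].
have /(relations_generated L_X1)[h hE] : eval_in iota (map_poly polyC p) x y = 0.
  rewrite eval_inE evalXY.unlock -map_poly_comp -[RHS]px; congr (_.[_]).
  by apply: eq_map_poly => c; rewrite /= evalX_C.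
have := congr1 swapXY hE; rewrite swapXY_map_polyC rmorphM /= => E.
have fE : swapXY f = 'X ^+ q0.+1 + ('X^4 + 'X^2)%:P.
  by rewrite /f /X1_poly !rmorphD !rmorphXn /= swapXY_X swapXY_Y addrC.
have f_size : size (swapXY f) = q0.+2 by rewrite fE size_XnaddC.
have [h0|h0] := eqVneq (swapXY h) 0.
  by move/eqP: E; rewrite h0 mul0r polyC_eq0 (negPf p0).
have := congr1 (fun u : {poly {poly K}} => size u) E.
rewrite size_mul // -?size_poly_eq0 ?f_size // size_polyC p0.
by move: h0; rewrite -size_poly_eq0; lia.
Qed.

Lemma X1_x_neq0 : x != 0.
Proof.
by apply/eqP => x0; apply: X1_x_transcendental; rewrite x0; apply: algebraic0.
Qed.

(** The parameter of the conic [w^2 + x^2 = -1], where [w = y^d / x]. *)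
Definition X1_t : L := y ^+ d / x + iota i0 * x.

Lemma X1_coordinates : coordinates iota d (4%:R * i0)^-1 X1_t y.
Proof.
have x0 := X1_x_neq0; set t := X1_t; pose s := y ^+ d / x - iota i0 * x.
have i2 : iota i0 ^+ 2 = -1 by rewrite -rmorphXn i0E rmorphN rmorph1.
have i00 : i0 != 0.
  by apply: contra_eqN i0E => /eqP->; rewrite expr0n eq_sym oppr_eq0 oner_eq0.
have w2 : (y ^+ d / x) ^+ 2 = - (x ^+ 2 + 1).
  by rewrite expr_div_n X1_relation mulNr mulrAC mulfV ?mul1r // expf_neq0.
have ts : t * s = -1.
  have -> : t * s = (y ^+ d / x) ^+ 2 - iota i0 ^+ 2 * x ^+ 2.
    by rewrite /t /X1_t /s; ring.
  by rewrite i2 w2; ring.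
have t0 : t != 0.
  by apply: contra_eqN ts => /eqP->; rewrite mul0r eq_sym oppr_eq0 oner_eq0.
have tV : t^-1 = - s by apply: (mulfI t0); rewrite mulfV // mulrN ts opprK.
have i2x : iota (2%:R * i0) != 0 by rewrite fmorph_eq0 mulf_neq0.
have xE : x = (t + t^-1) / iota (2%:R * i0).
  apply: (canRL (mulfK i2x)); rewrite tV /t /X1_t /s rmorphM rmorph_nat; ring.
split.
- move=> p pt; apply: contrapT => p0; apply: X1_x_transcendental.
  have t_alg : algebraicOver iota t.
    by exists p; [apply/eqP|apply/rootP; rewrite -evalXE].
  rewrite xE; apply: algebraic_div; last exact: algebraic_id.
  by apply: algebraic_add => //; apply: algebraic_inv.
- move=> F F_sf Ft Fy; apply: (function_field_generate L_X1) => //.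
  rewrite xE; apply: (subfield_mul F_sf).
    by apply: (subfield_add F_sf) => //; apply: (subfield_inv F_sf).
  by apply: (subfield_inv F_sf); apply: (subfield_const F_sf).
have E : t ^+ 4 - 1 = y ^+ d * t ^+ 2 * iota (4%:R * i0).
  have -> : t ^+ 4 - 1 = t ^+ 2 * (t ^+ 2 - s ^+ 2).
    have -> : t ^+ 2 * (t ^+ 2 - s ^+ 2) = t ^+ 4 - (t * s) ^+ 2 by ring.
    by rewrite ts sqrrN expr1n.
  have -> : y ^+ d = y ^+ d / x * x by rewrite divfK.
  rewrite /t /X1_t /s rmorphM rmorph_nat; ring.
rewrite E fmorphV [RHS]mulrC mulfK // fmorph_eq0 mulf_neq0 //.
by have -> : 4%:R = 2%:R ^+ 2 :> K; [ring|rewrite expf_neq0].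
Qed.

End Coordinates.

Theorem theorem4p3 (p k q0 Delta : nat)
    (p_prime : prime p) (k_gt0 : (0 < k)%N) (q0E : q0 = (p ^ k)%N)
    (DeltaE : Delta.*2 = q0.+1) (Delta_prime : prime Delta)
    (Delta_gt3 : (3 < Delta)%N)
    (K : finFieldType) (cardK : #|K| = (q0 ^ 2)%N)
    (L : fieldType) (iota : {rmorphism K -> L}) (x y : L)
    (L_X1 : is_function_field iota (X1_poly K q0) x y)
    (P3 : place iota) (P3_rational : rational_point P3)
    (H_q0S : weierstrass_semigroup P3 q0.+1)
    (H_q0S_Delta : weierstrass_semigroup P3 (q0.+1 - Delta)%N)
    (H_q0S_Delta2j : forall j : nat, (1 <= j <= (Delta.-1)./2)%N ->
       weierstrass_semigroup P3 (q0.+1 - (Delta - j.*2))%N) :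
  forall n : nat, weierstrass_semigroup P3 n <->
    generated_semigroup (P3_generators q0 Delta) n.
Proof.
have Delta_odd : odd Delta.
  by case/even_prime: Delta_prime => // D2; rewrite D2 in Delta_gt3.
pose e := Delta./2.
have De : Delta = e.*2.+1 by rewrite -[LHS]odd_double_half Delta_odd.
have e_gt0 : (0 < e)%N by move: Delta_gt3; rewrite De; case: (e).
have K_q0 : q0%:R = 0 :> K.
  have /pcharf0 p0 : p \in [pchar K].
    by apply: (@card_finPcharP _ p (k * 2)) => //; rewrite cardK q0E expnM.
  by rewrite q0E natrX p0 expr0n gtn_eqF.
(* In [K] the relation [2 Delta = q0 + 1] reads [2 Delta = 1], so that 2 and
   [Delta] are invertible. *)
have K_2Delta : Delta%:R * 2%:R = 1 :> K.
  by rewrite -natrM muln2 DeltaE -addn1 natrD K_q0 add0r.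
have [DeltaK K2] : Delta%:R != 0 :> K /\ 2%:R != 0 :> K.
  by apply/andP; rewrite -negb_or -mulf_eq0 K_2Delta oner_eq0.
(* [q0 = 4 e + 1], so [q0^2 - 1] is a multiple of 4. *)
have [i0 i0E] : exists i0 : K, i0 ^+ 2 = -1.
  apply: finField_sqrt_opp1; rewrite cardK.
  have -> : q0 = (4 * e).+1 by move: DeltaE; rewrite De; lia.
  by apply/dvdnP; exists (4 * e ^ 2 + 2 * e)%N; rewrite !expnS expn0; nia.
have co := X1_coordinates DeltaE L_X1 K2 i0E.
have C0 : (4%:R * i0)^-1 != 0 :> K.
  rewrite invr_eq0 mulf_neq0 //.
    by have -> : 4%:R = 2%:R ^+ 2 :> K; [ring|rewrite expf_neq0].
  by apply: contra_eqN i0E => /eqP->; rewrite expr0n eq_sym oppr_eq0 oner_eq0.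
have genH n : generated_semigroup (P3_generators q0 Delta) n ->
    weierstrass_semigroup P3 n.
  apply: weierstrass_generated => m; rewrite mem_rcons inE => /orP[/eqP->//|].
  move=> /mapP[[|j]]; rewrite mem_iota => /andP[_ j_lt] ->; first by rewrite subn0.
  exact: H_q0S_Delta2j.
have monoH n : monomial_order Delta n -> weierstrass_semigroup P3 n.
  by move=> /(monomial_order_generated DeltaE Delta_odd)/genH.
move=> n; split=> [nH|/genH //]; apply: monomial_order_generated => //.
have [t_lt0|t_ge0] := ltrP (ord_at P3 (X1_t iota Delta x y i0)) 0.
  exact: (weierstrass_pole De e_gt0 DeltaK K2 C0 i0E co t_lt0).
have [Q [Q_rat Qt Qy]] := place_at_infinity De e_gt0 DeltaK K2 C0 co.
exact: (weierstrass_finite De e_gt0 DeltaK K2 C0 i0E co P3_rational t_ge0 monoH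
  Q_rat Qt Qy).
Qed.
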